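(* Let $a_1,a_2$ be integers. For integers $m,n\ge0$ define, for $i=1,2$, $$A^{ii}_{mn}(q;a_1,a_2)=(-1)^n q^{(2a_i+1)(m(m+1)-n(n+1))/4}\frac{1}{[m+n+1]\,[m]!\,[n]!},$$ $$A^{12}_{mn}(q;a_1,a_2)=(-1)^n q^{\frac{(2a_1+1)m(m+1)-(2a_2+1)n(n+1)}{4}+\frac16}\sum_{s=0}^{\min(m,n)}\frac{q^{\frac12(s+1)(m+n-s)}}{[m-s]!\,[n-s]!},$$ $$A^{21}_{mn}(q;a_1,a_2)=-(-1)^n q^{\frac{(2a_2+1)m(m+1)-(2a_1+1)n(n+1)}{4}-\frac16}\sum_{s=0}^{\min(m,n)}\frac{q^{-\frac12(s+1)(m+n-s)}}{[m-s]!\,[n-s]!},$$ and let $$T(q;a_1,a_2)=\exp\Big(\sum_{i,j=1,2}\ \sum_{m,n=0}^\infty A^{ij}_{mn}(q;a_1,a_2)\,\psi^i_{m+\frac12}\psi^{j*}_{-n-\frac12}\Big).$$ Then for all partitions $\mu,\nu$, $$W^{(a_1,a_2,0)}_{\mu,\nu,\emptyset}(q)=\langle\mu,\nu|\,T(q;a_1,a_2)\,|0\rangle\otimes|0\rangle .$$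
   Context: **Scalars.** $q$ is an indeterminate and scalars lie in $\mathbb{C}(q^{1/12})$. $[n]=q^{n/2}-q^{-n/2}$, $[n]!=[1][2]\cdots[n]$, $[0]!=1$. **Partitions.** For a partition $\mu=(\mu_1\ge\dots\ge\mu_l>0)$, $|\mu|=\sum_i\mu_i$, $\kappa_\mu=\sum_{i=1}^l\mu_i(\mu_i-2i+1)$, and $\mu^t$ is the conjugate partition. $\emptyset$ is the empty partition. **Symmetric functions.** $s_{\mu/\nu}$ are skew Schur functions and $c^{\mu}_{\nu\lambda}$ the Littlewood–Richardson coefficients ($s_\nu s_\lambda=\sum_\mu c^\mu_{\nu\lambda}s_\mu$). For a symmetric function $f$, $f(q^{\rho})$ is the specialization at $q^\rho=(q^{-1/2},q^{-3/2},\dots)$, i.e. the power sums are sent to $p_n\mapsto 1/[n]$; $f(q^{-\rho})$ is the specialization at $(q^{1/2},q^{3/2},\dots)$, i.e. $p_n\mapsto -1/[n]$. **Topological vertex.** For partitions $\mu,\nu$, $$W_{\mu,\nu}(q)=(-1)^{|\mu|+|\nu|}q^{(\kappa_\mu+\kappa_\nu)/2}\sum_\eta s_{\mu/\eta}(q^{-\rho})s_{\nu/\eta}(q^{-\rho}).$$ For partitions $\mu^1,\mu^2,\mu^3$, $$W_{\mu^1,\mu^2,\mu^3}(q)=\sum_{\lambda,\tau}\Big(\sum_\eta c^{\mu^1}_{\eta\lambda}c^{(\mu^3)^t}_{\eta\tau^t}\Big)q^{\kappa_{\mu^2}/2+\kappa_{\mu^3}/2}\,\frac{W_{(\mu^2)^t,\lambda}(q)\,W_{\mu^2,\tau^t}(q)}{W_{\mu^2,\emptyset}(q)},$$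 and the framed topological vertex in framing $(a_1,a_2,a_3)$ is $W^{(a_1,a_2,a_3)}_{\mu^1,\mu^2,\mu^3}(q)=q^{(a_1\kappa_{\mu^1}+a_2\kappa_{\mu^2}+a_3\kappa_{\mu^3})/2}\,W_{\mu^1,\mu^2,\mu^3}(q)$. **Fermionic Fock space.** A set $A=\{a_1>a_2>\cdots\}\subset\mathbb{Z}+\frac12$ is admissible if both $A\setminus\{r<0\}$ and $\{r\in\mathbb{Z}+\frac12: r<0\}\setminus A$ are finite; its charge is the cardinality of the first set minus that of the second. $\mathcal{F}$ is the vector space with basis the semi-infinite wedges $\underline A=\underline{a_1}\wedge\underline{a_2}\wedge\cdots$, $A$ admissible, declared orthonormal. For $r\in\mathbb{Z}+\frac12$: $\psi_r\underline A=(-1)^k\,\underline{a_1}\wedge\cdots\wedge\underline{a_k}\wedge\underline r\wedge\underline{a_{k+1}}\wedge\cdots$ if $r\notin A$ and exactly $k\ge 0$ elements of $A$ exceed $r$, and $\psi_r\underline A=0$ if $r\in A$; $\psi_r^*\underline A=(-1)^{k+1}\underline{a_1}\wedge\cdots\wedge\widehat{\underline{a_k}}\wedge\cdots$ if $a_k=r$, and $\psi_r^*\underline A=0$ if $r\notin A$. For a partition $\mu$ (padded by zeros), $|\mu\rangle=\underline{A_\mu}$ with $A_\mu=\{\mu_i-i+\frac12: i\ge1\}$; $|0\rangle=|\emptyset\rangle$. **Two components.** On $\mathcal{F}\otimes\mathcal{F}$, $\psi^i_r,\psi^{i*}_r$ ($i=1,2$) are $\psi_r,\psi_r^*$ acting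 on the $i$-th factor with the Koszul sign convention, so that operators with different upper index anticommute: $\psi^1_r(u\otimes v)=\psi_ru\otimes v$ and $\psi^2_r(u\otimes v)=(-1)^{c}u\otimes\psi_rv$ for $u$ of charge $c$, and likewise for the starred operators. $\langle\mu,\nu|X$ denotes the coefficient of the basis vector $|\mu\rangle\otimes|\nu\rangle$ in the (formal, possibly infinite) sum $X$; for $X=T(|0\rangle\otimes|0\rangle)$ each such coefficient is a finite sum. *)

(* Defs.v *)
From HB Require Import structures.
From mathcomp Require Import all_boot all_order all_algebra.
From mathcomp Require Import finmap.
From mathcomp Require Import all_classical reals.
From mathcomp Require Import complex fraction.
From mathcomp.multinomials Require Import monalg.

Set Implicit Arguments.
Unset Strict Implicit.
Unset Printing Implicit Defensive.

Import Order.TTheory GRing.Theory Num.Theory.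
Local Open Scope classical_set_scope.
Local Open Scope ring_scope.

(* Conventions.
   - Sums \sum_(x \in [set: T]) over an infinite type T are the sums of finite
     support of fsbigop.
   - All definitions below are made over a field K with a distinguished element
     t playing the role of q^(1/12); they are used for K = C(t). *)

Definition is_part (s : seq nat) : bool := sorted geq s && (0%N \notin s).

Record intpart := IntPart { parts :> seq nat; partsP : is_part parts }.
HB.instance Definition _ := [isSub for parts].
HB.instance Definition _ := [Choice of intpart by <:].

Definition empty_part : intpart := @IntPart [::] isT.

Lemma conj_is_part (mu : intpart) :
  is_part (mkseq (fun j => count (fun x => (j < x)%N) mu) (head 0%N mu)).
Proof.
apply/andP; split.
  apply: (homo_sorted (e := ltn)); last exact: iota_ltn_sorted.
  move=> i j ij /=; apply: sub_count => x; exact: ltn_trans.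
apply/mapP => -[j]; rewrite mem_iota add0n => /andP[_].
by case: (parts mu) => // x s /= ->.
Qed.

Definition conj_part (mu : intpart) : intpart := IntPart (conj_is_part mu).

Definition psize (mu : intpart) : nat := sumn mu.

Definition kappa (mu : intpart) : int :=
  \sum_(i < size mu)
    (nth 0%N mu i)%:Z * ((nth 0%N mu i)%:Z - 2%:Z * i.+1%:Z + 1).

(* The ring of symmetric functions over a field of characteristic zero is the
   polynomial ring in the power sums p_1, p_2, ...; the variable of index k is
   p_(k+1). *)
Notation symfun K := {malg K[{cmonom nat}]}.

Section SymmetricFunctions.
Variable K : fieldType.
Local Notation Sym := (symfun K).

Definition psum (k : nat) : Sym := mkmalgU (ucm k) 1.

(* [:: h_0; ...; h_n], by Newton's identity n h_n = sum_(1<=k<=n) p_k h_(n-k) *)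
Fixpoint hsym_seq (n : nat) : seq Sym :=
  if n is m.+1 then
    let s := hsym_seq m in
    rcons s ((m.+1%:R)^-1 *: \sum_(k < m.+1) psum k * s`_(m - k))
  else [:: 1].

Definition hsym (n : nat) : Sym := (hsym_seq n)`_n.

Lemma size_hsym_seq n : size (hsym_seq n) = n.+1.
Proof. by elim: n => //= n IH; rewrite size_rcons IH. Qed.

Lemma nth_hsym_seq n k : (k <= n)%N -> (hsym_seq n)`_k = hsym k.
Proof.
elim: n => [|n IH]; first by rewrite leqn0 => /eqP->.
rewrite leq_eqVlt => /orP[/eqP->//|]; rewrite ltnS => kn.
by rewrite /= nth_rcons size_hsym_seq ltnS kn IH.
Qed.

Lemma hsym0 : hsym 0 = 1. Proof. by []. Qed.

Lemma hsymS n :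
  hsym n.+1 = (n.+1%:R)^-1 *: \sum_(k < n.+1) psum k * hsym (n - k).
Proof.
have -> : hsym n.+1 = (n.+1%:R)^-1 *: \sum_(k < n.+1) psum k * (hsym_seq n)`_(n - k).
  by rewrite [LHS]nth_rcons size_hsym_seq ltnn eqxx.
apply: congr1; apply: eq_bigr => k _.
by rewrite nth_hsym_seq // leq_subr.
Qed.

Definition hsymz (z : int) : Sym := if z is Posz n then hsym n else 0.

(* Jacobi-Trudi determinant det (h_(mu_i - nu_j - i + j)).  Its size has to
   reach the lengths of both partitions, so that it vanishes when nu is not
   contained in mu. *)
Definition skew_schur (mu nu : intpart) : Sym :=
  let N := maxn (size mu) (size nu) in
  \det (\matrix_(i < N, j < N)
          hsymz ((nth 0%N mu i)%:Z - (nth 0%N nu j)%:Z - i%:Z + j%:Z)).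

Definition schur (mu : intpart) : Sym := skew_schur mu empty_part.

Definition is_lr_expansion (nu la : intpart) (c : intpart -> int) : Prop :=
  finite_set [set mu | c mu != 0] /\
  schur nu * schur la = \sum_(mu \in [set: intpart]) (c mu)%:~R *: schur mu.

(* c^mu_(nu la) *)
Definition lr_coef (mu nu la : intpart) : int :=
  xget (fun=> 0) [set c | is_lr_expansion nu la c] mu.

(* The K-algebra morphism p_n |-> phi n, for n >= 1. *)
Definition specialize (phi : nat -> K) (f : Sym) : K :=
  mmap idfun
    (fun m : {cmonom nat} => \prod_(k <- finsupp m) phi k.+1 ^+ m k) f.

End SymmetricFunctions.

Section Vertex.
Variables (K : fieldType) (t : K).

(* q^(k/12) *)
Definition qpow12 (k : int) : K := t ^ k.

Definition qnum (n : nat) : K := qpow12 (6%:Z * n%:Z) - qpow12 (- (6%:Z * n%:Z)).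

Definition qfact (n : nat) : K := \prod_(1 <= i < n.+1) qnum i.

(* f(q^(-rho)) *)
Definition at_qmrho (f : symfun K) : K :=
  specialize (fun n => - (qnum n)^-1) f.

Definition W2 (mu nu : intpart) : K :=
  (-1) ^+ (psize mu + psize nu) * qpow12 (6%:Z * (kappa mu + kappa nu)) *
  \sum_(eta \in [set: intpart])
    at_qmrho (skew_schur K mu eta) * at_qmrho (skew_schur K nu eta).

Definition W3 (mu1 mu2 mu3 : intpart) : K :=
  \sum_(la \in [set: intpart]) \sum_(tau \in [set: intpart])
    (\sum_(eta \in [set: intpart])
        lr_coef K mu1 eta la * lr_coef K (conj_part mu3) eta (conj_part tau))%:~R
    * qpow12 (6%:Z * kappa mu2 + 6%:Z * kappa mu3)
    * (W2 (conj_part mu2) la * W2 mu2 (conj_part tau) / W2 mu2 empty_part).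

Definition framed_W3 (a1 a2 a3 : int) (mu1 mu2 mu3 : intpart) : K :=
  qpow12 (6%:Z * (a1 * kappa mu1 + a2 * kappa mu2 + a3 * kappa mu3))
  * W3 mu1 mu2 mu3.

End Vertex.

(* The half-integer k + 1/2 is encoded by the integer k: m + 1/2 is [Posz m],
   and -n - 1/2 is [Negz n]. *)
Definition admissible (A : set int) : Prop :=
  finite_set (A `&` [set k | 0 <= k]) /\ finite_set ([set k | k < 0] `\` A).

Record adm := Adm { adm_set :> set int; admP : `[< admissible adm_set >] }.
HB.instance Definition _ := [isSub for adm_set].
HB.instance Definition _ := [Choice of adm by <:].

Lemma add_admissible (A : adm) (k : int) :
  `[< admissible (adm_set A `|` [set k]) >].
Proof.
case: A => A /= /asboolP[fin1 fin2]; apply/asboolP; split.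
  rewrite setIUl finite_setU; split=> //.
  by apply: sub_finite_set (finite_set1 k) => x [].
by apply: sub_finite_set fin2 => x [x0 nx]; split=> // Ax; apply: nx; left.
Qed.

Lemma del_admissible (A : adm) (k : int) :
  `[< admissible (adm_set A `\` [set k]) >].
Proof.
case: A => A /= /asboolP[fin1 fin2]; apply/asboolP; split.
  by apply: sub_finite_set fin1 => x [[]].
apply: (@sub_finite_set _ _ (([set k | k < 0] `\` A) `|` [set k])).
  move=> x [x0 nx]; have [->|xk] := eqVneq x k; first by right.
  by left; split=> // Ax; apply: nx; split=> // /eqP; rewrite (negbTE xk).
by rewrite finite_setU; split=> //; exact: finite_set1.
Qed.

Definition adm_add (A : adm) (k : int) : adm := Adm (add_admissible A k).
Definition adm_del (A : adm) (k : int) : adm := Adm (del_admissible A k).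

Definition n_above (k : int) (A : adm) : nat :=
  #|` fset_set (adm_set A `&` [set j | k < j]) |%fset.

Definition charge (A : adm) : int :=
  (#|` fset_set (adm_set A `&` [set k | 0 <= k]) |%fset)%:Z
  - (#|` fset_set ([set k | k < 0] `\` adm_set A) |%fset)%:Z.

(* A_mu = {mu_i - i + 1/2 : i >= 1}; the index i below starts at 0. *)
Definition maya_set (mu : intpart) : set int :=
  [set k | exists i : nat, k = (nth 0%N mu i)%:Z - i.+1%:Z].

Lemma maya_admissible (mu : intpart) : `[< admissible (maya_set mu) >].
Proof.
apply/asboolP; split.
  apply: (@sub_finite_set _ _
    ((fun i : nat => (nth 0%N mu i)%:Z - i.+1%:Z) @` `I_(size mu))).
    move=> _ [[i ->]] /= k0; exists i => //=; rewrite ltnNge; apply/negP => ge.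
    by move: k0; rewrite nth_default // sub0r oppr_ge0.
  by apply: finite_image; exact: finite_II.
apply: (@sub_finite_set _ _ (Negz @` `I_(size mu))).
  move=> [n|n] [//= _ nA]; exists n => //=.
  rewrite ltnNge; apply/negP => ge; apply: nA; exists n.
  by rewrite nth_default // sub0r NegzE.
by apply: finite_image; exact: finite_II.
Qed.

Definition maya (mu : intpart) : adm := Adm (maya_admissible mu).

Section Fock.
Variable K : fieldType.

(* A possibly infinite formal sum of basis vectors indexed by B is the function
   B -> K of its coefficients; F is contained in adm -> K, and F (x) F is
   contained in adm * adm -> K. *)
Definition fvec (B : Type) := B -> K.

Definition basis (B : eqType) (b : B) : fvec B := fun b' => (b' == b)%:R.

(* Extension to formal sums of an operator given on the basis vectors; it is
   only used for operators f such that, for each b', f b b' <> 0 for finitely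
   many b. *)
Definition lin_ext (B B' : choiceType) (f : B -> fvec B') (v : fvec B) :
  fvec B' := fun b' => \sum_(b \in [set: B]) v b * f b b'.

Definition psi (k : int) (A : adm) : fvec adm :=
  if k \in adm_set A then fun=> 0
  else fun B => (-1) ^+ n_above k A * basis (adm_add A k) B.

(* k is the element of index (n_above k A).+1 of A *)
Definition psi_star (k : int) (A : adm) : fvec adm :=
  if k \in adm_set A then
    fun B => (-1) ^+ (n_above k A).+2 * basis (adm_del A k) B
  else fun=> 0.

Definition tensor (u v : fvec adm) : fvec (adm * adm) :=
  fun AB => u AB.1 * v AB.2.

(* The tensor factors 1 and 2 are indexed by [false] and [true]. *)
Definition on_factor (i : bool) (f : adm -> fvec adm) (AB : adm * adm) :
    fvec (adm * adm) :=
  if i then fun CD => (-1) ^ charge AB.1 * tensor (basis AB.1) (f AB.2) CD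
  else tensor (f AB.1) (basis AB.2).

Definition psi2 (i : bool) (k : int) : fvec (adm * adm) -> fvec (adm * adm) :=
  lin_ext (on_factor i (psi k)).

Definition psi2_star (i : bool) (k : int) :
    fvec (adm * adm) -> fvec (adm * adm) :=
  lin_ext (on_factor i (psi_star k)).

(* |mu> (x) |nu> *)
Definition ket2 (mu nu : intpart) : fvec (adm * adm) :=
  tensor (basis (maya mu)) (basis (maya nu)).

(* <mu, nu| X *)
Definition bra2 (mu nu : intpart) (X : fvec (adm * adm)) : K :=
  X (maya mu, maya nu).

(* The sum over k is finite at each b when X = T_exponent and v = |0> (x) |0>:
   each factor X creates a particle at some m + 1/2, and none is ever removed. *)
Definition fexp (B : Type) (X : fvec B -> fvec B) (v : fvec B) : fvec B :=
  fun b => \sum_(k \in [set: nat]) (k`!%:R)^-1 * iter k X v b.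

Variable t : K.
Local Notation "''q12^' k" := (qpow12 t k) (at level 8, k at level 2).

Definition A_diag (a : int) (m n : nat) : K :=
  (-1) ^+ n
  * 'q12^(3%:Z * (2%:Z * a + 1) * ((m * m.+1)%:Z - (n * n.+1)%:Z))
  * (qnum t (m + n).+1 * qfact t m * qfact t n)^-1.

Definition A_12 (a1 a2 : int) (m n : nat) : K :=
  (-1) ^+ n
  * 'q12^(3%:Z * ((2%:Z * a1 + 1) * (m * m.+1)%:Z
                  - (2%:Z * a2 + 1) * (n * n.+1)%:Z) + 2%:Z)
  * \sum_(s < (minn m n).+1)
      'q12^(6%:Z * (s.+1 * (m + n - s))%:Z)
      / (qfact t (m - s) * qfact t (n - s)).

Definition A_21 (a1 a2 : int) (m n : nat) : K :=
  - (-1) ^+ n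
  * 'q12^(3%:Z * ((2%:Z * a2 + 1) * (m * m.+1)%:Z
                  - (2%:Z * a1 + 1) * (n * n.+1)%:Z) - 2%:Z)
  * \sum_(s < (minn m n).+1)
      'q12^(- (6%:Z * (s.+1 * (m + n - s))%:Z))
      / (qfact t (m - s) * qfact t (n - s)).

Definition A_coef (a1 a2 : int) (i j : bool) : nat -> nat -> K :=
  match i, j with
  | false, false => A_diag a1
  | true, true => A_diag a2
  | false, true => A_12 a1 a2
  | true, false => A_21 a1 a2
  end.

(* Each coefficient of the result is a finite sum: a basis vector with nonzero
   coefficient in the (m, n) term contains m + 1/2 and omits -n - 1/2. *)
Definition T_exponent (a1 a2 : int) (v : fvec (adm * adm)) : fvec (adm * adm) :=
  fun AB =>
    \sum_(i : bool) \sum_(j : bool) \sum_(mn \in [set: nat * nat])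
      A_coef a1 a2 i j mn.1 mn.2
      * psi2 i (Posz mn.1) (psi2_star j (Negz mn.2) v) AB.

Definition T_op (a1 a2 : int) : fvec (adm * adm) -> fvec (adm * adm) :=
  fexp (T_exponent a1 a2).

End Fock.

(* C(q^(1/12)), with C = R[i] *)
Definition scalars (R : realType) : fieldType := {fraction {poly R[i]}}.

Definition q12 (R : realType) : scalars R := tofrac ('X : {poly R[i]}).

(* Main.v *)
Require Import Defs.
From HB Require Import structures.
From mathcomp Require Import all_boot all_order all_algebra.
From mathcomp Require Import perm finmap.
From mathcomp Require Import all_classical reals.
From mathcomp Require Import complex fraction ring zify.
From mathcomp.multinomials Require Import monalg.

Set Implicit Arguments.
Unset Strict Implicit.
Unset Printing Implicit Defensive.

Import Order.TTheory GRing.Theory Num.Theory.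
Local Open Scope ring_scope.

(** Both sides are Pluecker coordinates of one point of a Grassmannian: the
    left one in the form of a minor of a product of Toeplitz matrices, the right
    one in an affine chart.

    On the left, an empty third leg kills all but one Littlewood-Richardson
    term, and the framed vertex is (-1)^(|mu|+|nu|) times a power of q times
    sum_eta s_(mu/eta) s_(nu^t/eta) at q^(-rho) ([W3_empty]).  Each skew Schur
    function is a Jacobi-Trudi determinant in differences of the beads
    mu_i - i, so by Cauchy-Binet the sum over eta is one determinant
    det G(mu_i - i, nu^t_j - j), where G(k, c) = sum_(l >= -N) h_(k-l) h_(c-l)
    and N is any bound on the partitions ([sum_skew]).

    Stack the rows of G, all cut to the columns of the window [-N, N), on top
    of unit rows e_(-1-k), one for each k in the window.  The rows indexed by
    the beads of mu in the first family and the beads of nu in the second have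
    as determinant the minor above, up to sign: the unit rows delete the columns
    -1-k with k a bead of nu, and those that survive are the beads of nu^t
    ([maya_conj], [rdet_state]).  Powers of q enter as weights of the rows.

    On the right, suppose that every row of a mode m + 1/2 is the combination,
    with coefficients A^{ij}_{mn}, of the rows of the modes -n - 1/2.  Replacing
    one such row of the determinant of a state by this combination is the same
    as applying psi^i_{m+1/2} psi^{j*}_{-n-1/2} backwards: the fermionic signs
    are the signs of moving a row to the front of the list and back.  Hence the
    k-th power of the exponent takes the vacuum to k! times the determinants of
    the states with k particles, and exp gives all the determinants, normalised
    at the vacuum ([iter_bilinear], [fexp_bilinear]).

    It remains to check the linear relations between the rows.  Since G = L U
    with L lower triangular Toeplitz in the h_n and U its transpose, and the
    inverse of L is Toeplitz in (-1)^n e_n, the coefficients are hook sums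
    sum_p (-1)^(n-p) e_(n-p) h_(m+1+p) and the overlaps sum_s h_(m-s) h_(n-s) and
    sum_s (-1)^(m+n) e_(m-s) e_(n-s) ([pairing_particle],
    [pairing_hole_inverse]).  At q^(-rho) the functions h_n and e_n are
    monomials over q-factorials, the overlaps are A^{12} and A^{21} term by term,
    and the hook sums have a closed form that gives A^{11} and A^{22}
    ([particle_row_relation]).

    Two facts about Schur functions are needed to reach the two-legged vertex:
    they are linearly independent ([schur_independent]), so that the
    Littlewood-Richardson coefficients are what they should be, and they do not
    vanish at q^(-rho) ([jt_complete_q_neq0]), so that the quotient in the vertex
    cancels. *)

(** * Specializations of Jacobi-Trudi determinants *)

Section Specialization.
Variables (K : fieldType) (phi : nat -> K).

(** The value at the point phi of a monomial in the power sums, named so that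
    it can carry the structure that makes specialization a ring morphism. *)
Definition monom_value (m : {cmonom nat}) : K :=
  \prod_(k <- finsupp m) phi k.+1 ^+ m k.

Lemma monom_valueE (m : {cmonom nat}) (D : {fset nat}) :
  (finsupp m `<=` D)%fset -> monom_value m = \prod_(k <- D) phi k.+1 ^+ m k.
Proof.
move=> sD; rewrite /monom_value; apply: big_fset_incl => // k _ km.
by rewrite (fsfun_dflt km) expr0.
Qed.

Fact monom_value_mmorphism : mmorphism monom_value.
Proof.
split=> [x y|]; last by rewrite /monom_value mdom1 big_seq_fset0.
pose D := (finsupp x `|` finsupp y)%fset.
rewrite !(@monom_valueE _ D) ?fsubsetUl ?fsubsetUr ?mdomD //.
by rewrite -big_split; apply: eq_bigr => k _; rewrite cmM exprD.
Qed.

HB.instance Definition _ :=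
  isMultiplicative.Build {cmonom nat} K monom_value monom_value_mmorphism.

Definition spec_rmorph : {rmorphism symfun K -> K} :=
  mmap (@idfun K) monom_value.

Lemma specializeE : specialize phi = spec_rmorph.
Proof. by []. Qed.

Lemma specializeZ c f : specialize phi (c *: f) = c * specialize phi f.
Proof. exact: (@mmapZ _ _ _ idfun monom_value). Qed.

Lemma specialize_psum k : specialize phi (psum K k) = phi k.+1.
Proof.
transitivity (monom_value (ucm k)).
  by rewrite /specialize /psum mmapU /= mul1r.
rewrite /monom_value.
by rewrite mdomU big_seq_fset1 cmUU expr1.
Qed.

End Specialization.

Lemma geq_transitive : transitive geq.
Proof. by move=> y x z /= h1 h2; apply: leq_trans h2 h1. Qed.

Lemma part_sorted (mu : intpart) : sorted geq mu.
Proof. by have /andP[] := partsP mu. Qed.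

Lemma nth_part_le (mu : intpart) i j : (i <= j)%N -> (nth 0 mu j <= nth 0 mu i)%N.
Proof.
move=> ij; case: (ltnP j (size mu)) => [jm|/(nth_default 0%N)->//].
apply: (sorted_leq_nth geq_transitive leqnn 0%N (part_sorted mu)) => //.
exact: leq_ltn_trans jm.
Qed.

Lemma nth_part_gt0 (mu : intpart) i : (i < size mu)%N -> (0 < nth 0 mu i)%N.
Proof.
move=> lt; rewrite lt0n; apply: contraTneq (partsP mu) => e0.
by rewrite /is_part negb_and negbK -e0 mem_nth ?orbT.
Qed.

Section JacobiTrudi.
Variable K : fieldType.
Implicit Types (mu nu : intpart) (h : nat -> K).

(** The convention h_n = 0 for n < 0. *)
Definition zext h (z : int) : K := if z is Posz n then h n else 0.

(** The position mu_i - i of the i-th bead of the Maya diagram, with i counted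
    from 0.  The Jacobi-Trudi entry h_(mu_i - nu_j - i + j) depends only on
    the difference of two beads. *)
Definition bead (mu : intpart) (i : nat) : int :=
  (nth 0%N mu i)%:Z - i.+1%:Z.

Definition jt h N mu nu : K :=
  \det (\matrix_(i < N, j < N) zext h (bead mu i - bead nu j)).

Lemma zext_neg h z : z < 0 -> zext h z = 0.
Proof. by case: z. Qed.

(** A zero part added to both partitions gives a last row equal to (0, ..., 0,
    h_0), so the size of the determinant is immaterial. *)
Lemma jt_stableS h N mu nu : h 0 = 1 ->
  (size mu <= N)%N -> (size nu <= N)%N -> jt h N.+1 mu nu = jt h N mu nu.
Proof.
move=> h0 smu snu; rewrite /jt (expand_det_row _ ord_max).
rewrite (bigD1 ord_max) //= big1 ?addr0 => [|j jN].
  rewrite !mxE /bead !nth_default //= subrr /= h0 mul1r /cofactor -signr_odd.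
  rewrite addnn odd_double mul1r; congr (\det _).
  by apply/matrixP => i j; rewrite !mxE !lift_max.
rewrite !mxE zext_neg ?mul0r // /bead (nth_default _ smu).
have : (j < N)%N by rewrite ltn_neqAle -ltnS ltn_ord andbT.
rewrite /=; lia.
Qed.

Lemma jt_stable h N mu nu : h 0 = 1 -> (size mu <= N)%N -> (size nu <= N)%N ->
  jt h (maxn (size mu) (size nu)) mu nu = jt h N mu nu.
Proof.
move=> h0 smu snu; have /subnKC <- : (maxn (size mu) (size nu) <= N)%N by rewrite geq_max smu.
elim: (N - _)%N => [|d IH]; first by rewrite addn0.
by rewrite addnS jt_stableS // -?IH // (leq_trans _ (leq_addr _ _)) ?leq_maxl ?leq_maxr.
Qed.

Variables (phi h : nat -> K).
Hypothesis char0 : forall n, n.+1%:R != 0 :> K.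
Hypothesis h0 : h 0 = 1.
Hypothesis newton :
  forall n, n.+1%:R * h n.+1 = \sum_(k < n.+1) phi k.+1 * h (n - k)%N.

(** Newton's identities determine the h_n from the power sums, so a sequence
    that satisfies them at the point phi is the specialization. *)
Lemma specialize_hsym n : specialize phi (hsym K n) = h n.
Proof.
elim/ltn_ind: n => -[|n] IH.
  by rewrite hsym0 specializeE rmorph1.
rewrite hsymS specializeZ specializeE rmorph_sum /=.
apply: (mulfI (char0 n)); rewrite mulrA divff // mul1r newton.
apply: eq_bigr => k _; rewrite rmorphM /=.
by rewrite -specializeE specialize_psum IH // ltnS leq_subr.
Qed.

Lemma specialize_skew mu nu N : (size mu <= N)%N -> (size nu <= N)%N ->
  specialize phi (skew_schur K mu nu) = jt h N mu nu.
Proof.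
move=> smu snu; rewrite -(jt_stable h0 smu snu) /skew_schur specializeE.
rewrite -det_map_mx; congr (\det _); apply/matrixP => i j; rewrite !mxE.
have -> : bead mu i - bead nu j
  = (nth 0%N mu i)%:Z - (nth 0%N nu j)%:Z - i%:Z + j%:Z by rewrite /bead; lia.
case: (_ + _) => n /=; last by rewrite rmorph0.
by rewrite -specializeE specialize_hsym.
Qed.

(** The row of index size nu - 1 only has entries h_n with n < 0, because the
    corresponding part of mu is zero while all parts of nu are positive. *)
Lemma specialize_skew_long mu nu : (size mu < size nu)%N ->
  specialize phi (skew_schur K mu nu) = 0.
Proof.
move=> lt; have [N sN] : exists N, size nu = N.+1 by exists (size nu).-1; lia.
rewrite (@specialize_skew _ _ N.+1) -?sN ?(ltnW lt) // /jt sN.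
rewrite (expand_det_row _ ord_max) big1 // => j _; rewrite !mxE zext_neg ?mul0r //.
rewrite /bead nth_default /=; last by rewrite -ltnS -sN.
have : (0 < nth 0 nu j)%N by rewrite nth_part_gt0 // sN.
have := ltn_ord j; lia.
Qed.

(** The first column only has entries h_n with n < 0. *)
Lemma specialize_skew_wide mu nu : (head 0 mu < head 0 nu)%N ->
  specialize phi (skew_schur K mu nu) = 0.
Proof.
move=> lt; have s0 : (0 < size nu)%N by case: (parts nu) lt.
rewrite (@specialize_skew _ _ (maxn (size mu) (size nu))) ?leq_maxl ?leq_maxr // /jt.
have : (0 < maxn (size mu) (size nu))%N by rewrite leq_max s0 orbT.
case: (maxn _ _) => // N _.
rewrite (expand_det_col _ ord0) big1 // => j _; rewrite !mxE zext_neg ?mul0r //.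
have : (nth 0 mu j <= head 0 mu)%N by rewrite -nth0 nth_part_le.
have -> : bead nu (@ord0 N) = (head 0 nu)%:Z - 1 by rewrite /bead nth0.
rewrite /bead; move: lt; case: j => j jN /=; move: (nth _ _ _) (head _ _) (head _ _) => a b c.
lia.
Qed.

End JacobiTrudi.

(** * Determinants whose rows are listed by a sequence *)

Section RowDeterminant.
Variables (K : comNzRingType) (T : eqType) (x0 : T) (M : nat) (Y : T -> 'rV[K]_M).
Implicit Types (s l : seq T).

(** Rows are named by the elements of a sequence rather than by ordinals, so
    that inserting, deleting and moving rows are operations on sequences. *)
Definition rdet s : K := \det (\matrix_(i < M) Y (nth x0 s i)).

Lemma rdet_swap l1 a b l2 : size (l1 ++ a :: b :: l2) = M ->
  rdet (l1 ++ a :: b :: l2) = - rdet (l1 ++ b :: a :: l2).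
Proof.
rewrite size_cat /= => sM.
have i0M : (size l1 < M)%N by lia.
have i1M : ((size l1).+1 < M)%N by lia.
pose i0 := Ordinal i0M; pose i1 := Ordinal i1M.
have ni : i0 != i1 by rewrite -val_eqE /=; lia.
rewrite /rdet.
set A := (X in \det X = _); set B := (X in _ = - \det X).
have -> : A = perm_mx (tperm i0 i1) *m B.
  rewrite -row_permE; apply/matrixP => i j.
  rewrite !mxE; congr (Y _ _ _); rewrite !nth_cat.
  case: tpermP => [->|->|/eqP n0 /eqP n1] /=.
  - by rewrite ltnn subnn /= ltnNge leqnSn /= subSnn.
  - by rewrite ltnn subnn /= ltnNge leqnSn /= subSnn.
  - case: ltnP => // le; have : (i != size l1 :> nat) by [].
    have : (i != (size l1).+1 :> nat) by [].
    case e : (i - size l1)%N => [|[|k]] //=; lia.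
by rewrite det_mulmx det_perm odd_tperm ni expr1 mulN1r.
Qed.

(** The sign of moving a row to the left is the parity of the number of rows
    jumped over; every fermionic sign below is an instance of it. *)
Lemma rdet_move p mid x l : size (p ++ mid ++ x :: l) = M ->
  rdet (p ++ mid ++ x :: l) = (-1) ^+ size mid * rdet (p ++ x :: mid ++ l).
Proof.
elim: mid p => [|a mid IH] p sM; first by rewrite mul1r.
rewrite cat_cons -cat_rcons IH ?cat_rcons //.
rewrite rdet_swap /=; last by move: sM; rewrite /= !(size_cat, size_rcons) /= !(size_cat, size_rcons) /=; lia.
by rewrite exprS mulN1r mulrN mulNr.
Qed.

Lemma rdet_front l1 x l2 : size (l1 ++ x :: l2) = M ->
  rdet (l1 ++ x :: l2) = (-1) ^+ size l1 * rdet (x :: l1 ++ l2).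
Proof. exact: (@rdet_move [::]). Qed.

Lemma rdet_linear (I : Type) (r : seq I) (c : I -> K) (y : I -> T) x l :
  size (x :: l) = M -> Y x = \sum_(i <- r) c i *: Y (y i) ->
  rdet (x :: l) = \sum_(i <- r) c i * rdet (y i :: l).
Proof.
rewrite /rdet; case: M Y => // M' Z [_] e.
have cof (z : T) j : cofactor (\matrix_(i < M'.+1) Z (nth x0 (z :: l) i)) ord0 j
    = cofactor (\matrix_(i < M'.+1) Z (nth x0 (x :: l) i)) ord0 j.
  rewrite /cofactor; congr (_ * \det _).
  by apply/matrixP => i k; rewrite !mxE.
rewrite (expand_det_row _ ord0).
under eq_bigr => j _ do rewrite mxE /= e summxE mulr_suml.
rewrite exchange_big /=; apply: eq_bigr => i _.
rewrite (expand_det_row _ ord0) mulr_sumr; apply: eq_bigr => j _.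
by rewrite (cof (y i)) !mxE /= -mulrA.
Qed.

Lemma rdet_dup y l : size (y :: l) = M -> y \in l -> rdet (y :: l) = 0.
Proof.
move=> /= sM yl.
have i0M : (0 < M)%N by lia.
have i1M : ((index y l).+1 < M)%N by rewrite -sM ltnS index_mem.
apply: (@determinant_alternate _ _ _ (Ordinal i0M) (Ordinal i1M)) => // j.
by rewrite !mxE /= nth_index.
Qed.

(** The number of adjacent transpositions used to bring a sequence to the
    form: elements satisfying P in order, then the others in reverse order. *)
Fixpoint shuffle_count (P : pred T) r : nat :=
  if r is x :: r' then ((if P x then 0 else size r') + shuffle_count P r')%N
  else 0.

(** With the rejected elements in reverse order, a rejected head sits at the
    very end of the list, so bringing it back jumps over all the remaining
    elements, whatever P does with them.  The sign then only depends on
    positions in r. *)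
Lemma rdet_shuffle (P : pred T) r : size r = M ->
  rdet (seq.filter P r ++ rev (seq.filter (predC P) r))
  = (-1) ^+ shuffle_count P r * rdet r.
Proof.
(* The induction needs a prefix p of rows that are already in place. *)
suff H p : size (p ++ r) = M ->
    rdet (p ++ seq.filter P r ++ rev (seq.filter (predC P) r))
    = (-1) ^+ shuffle_count P r * rdet (p ++ r) by exact: (H [::]).
elim: r p => [|x r IH] p sM /=; first by rewrite mul1r.
have sM' : size (rcons p x ++ r) = M by rewrite cat_rcons.
case: ifP => Px /=; first by rewrite -!cat_rcons add0n IH.
have ss : size (seq.filter P r ++ rev (seq.filter (predC P) r)) = size r.
  by rewrite size_cat size_rev !size_filter count_predC.
rewrite rev_cons -cats1 -[in rev _ ++ _](cats0 [:: x]).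
rewrite [seq.filter P r ++ _]catA cat1s rdet_move; last first.
  by move: sM; rewrite !size_cat /= addn1 => <-; rewrite -ss size_cat; lia.
by rewrite cats0 -cat_rcons IH // cat_rcons ss exprD mulrA.
Qed.

End RowDeterminant.

(** * Partitions as sets of beads *)

Section Beads.
Implicit Types (mu nu : intpart) (k : int).

Lemma bead_decr mu i j : (i < j)%N -> bead mu j < bead mu i.
Proof.
by rewrite /bead => ij; have := nth_part_le mu (ltnW ij); lia.
Qed.

Lemma bead_inj mu : injective (bead mu).
Proof.
move=> i j e; case: (ltngtP i j) => // /(bead_decr mu); rewrite e ltxx //.
Qed.

Lemma in_maya mu k : (k \in adm_set (maya mu)) = `[< exists i, k = bead mu i >].
Proof. by apply/idP/asboolP; rewrite inE. Qed.

Lemma in_maya_bead mu i : bead mu i \in adm_set (maya mu).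
Proof. by rewrite in_maya; apply/asboolP; exists i. Qed.

Fixpoint desc (lo : int) (n : nat) : seq int :=
  if n is n'.+1 then lo + n'%:Z :: desc lo n' else [::].

Lemma size_desc lo n : size (desc lo n) = n.
Proof. by elim: n => //= n ->. Qed.

Lemma mem_desc lo n k : (k \in desc lo n) = (lo <= k) && (k < lo + n%:Z).
Proof.
elim: n => [|n IH]; rewrite ?in_nil ?in_cons /= ?IH; last by case: eqP; lia.
by apply/esym/negbTE; lia.
Qed.

Lemma desc_sorted lo n : sorted >%R (desc lo n).
Proof.
case: n => //= n; elim: n => //= n ->; rewrite andbT; lia.
Qed.

Lemma gtz_trans : transitive (>%R : rel int).
Proof. by move=> y x z /= h1 h2; apply: lt_trans h2 h1. Qed.

Lemma desc_uniq lo n : uniq (desc lo n).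
Proof. by apply: (sorted_uniq gtz_trans ltxx); exact: desc_sorted. Qed.

(** The reflection k + 1/2 -> -(k + 1/2) of half-integers, in the encoding by
    integers. *)
Definition flip k : int := -1 - k.

Lemma flipK : involutive flip.
Proof. by move=> k; rewrite /flip; lia. Qed.

(** The half-integers between -N and N, in decreasing order.  Everything
    happens in this window once N bounds the lengths and the first parts of
    the partitions. *)
Definition window N : seq int := desc (- N%:Z) (N + N).

Definition beads N mu : seq int := mkseq (bead mu) N.

Lemma size_window N : size (window N) = (N + N)%N.
Proof. exact: size_desc. Qed.

Lemma mem_window N k : (k \in window N) = (- N%:Z <= k) && (k < N%:Z).
Proof. by rewrite mem_desc; congr andb; lia. Qed.

Lemma flip_window N : map flip (window N) = rev (window N).
Proof.
apply: (irr_sorted_eq lt_trans ltxx).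
- rewrite sorted_map; apply: sub_sorted (desc_sorted _ _) => x y /=.
  rewrite /flip; lia.
- by rewrite rev_sorted; exact: desc_sorted.
move=> k; rewrite mem_rev -[k]flipK (mem_map (can_inj flipK)) !mem_window /flip.
lia.
Qed.

Lemma beads_sorted N mu : sorted >%R (beads N mu).
Proof.
rewrite sorted_map; apply: (sub_sorted _ (iota_ltn_sorted 0 N)) => i j /=.
exact: bead_decr.
Qed.

Lemma maya_low mu k N : (size mu <= N)%N -> k < - N%:Z ->
  k \in adm_set (maya mu).
Proof.
move=> sN kN; rewrite in_maya; apply/asboolP; exists (absz (k + 1)).
rewrite /bead nth_default; lia.
Qed.

Lemma maya_high mu k N : (head 0 mu <= N)%N -> k \in adm_set (maya mu) ->
  k < N%:Z.
Proof.
move=> hN; rewrite in_maya => /asboolP[i ->].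
by have := nth_part_le mu (leq0n i); rewrite /bead nth0; lia.
Qed.

Lemma beads_window N mu : (size mu <= N)%N -> (head 0 mu <= N)%N ->
  beads N mu = [seq k <- window N | k \in adm_set (maya mu)].
Proof.
move=> sN hN; apply: (irr_sorted_eq gtz_trans ltxx (beads_sorted _ _)).
  by apply: sorted_filter (desc_sorted _ _); exact: gtz_trans.
move=> k; rewrite mem_filter mem_window; apply/mapP/andP.
  case=> i; rewrite mem_iota => iN ->; split; first exact: in_maya_bead.
  rewrite (maya_high hN) ?in_maya_bead // andbT.
  by move: iN; rewrite /bead; lia.
case=> kA /andP[k1 _]; move: kA; rewrite in_maya => /asboolP[i e].
exists i => //; rewrite mem_iota; case: ltnP => // iN.
by move: k1; rewrite e /bead nth_default ?(leq_trans sN iN) //; lia.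
Qed.

(** The box (i, j) belongs to the diagram iff it is in row i of mu, iff it is
    in column j. *)
Lemma count_part_gt mu i j : (i < count (fun x => (j < x)%N) mu)%N
  = (j < nth 0 mu i)%N.
Proof.
have := part_sorted mu; elim: (parts mu) i => [|x s IH] i; first by rewrite nth_nil.
move=> /= xs; case: (ltnP j x) => jx.
  by case: i => [|i] //=; rewrite add1n ltnS IH // (path_sorted xs).
have le i' : (nth 0 (x :: s) i' <= j)%N.
  case: (ltnP i' (size (x :: s))) => [lt|/(nth_default 0%N)-> //].
  apply: leq_trans jx.
  have /allP := order_path_min geq_transitive xs.
  case: i' lt => // i' lt H /=; exact: (H _ (mem_nth _ _)).
rewrite add0n.
have -> : count (fun x => (j < x)%N) s = 0%N.
  apply/eqP; rewrite eqn0Ngt -has_count; apply/hasPn => y /(nthP 0%N)[i' _ <-].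
  by rewrite -leqNgt (le i'.+1).
by rewrite ltn0 ltnNge le.
Qed.

Lemma nth_conj mu j : nth 0%N (conj_part mu) j = count (fun x => (j < x)%N) mu.
Proof.
rewrite /=; case: (ltnP j (head 0 mu)%N) => h; first by rewrite nth_mkseq.
rewrite nth_default ?size_mkseq //; apply/esym/eqP.
by rewrite eqn0Ngt count_part_gt nth0 -leqNgt.
Qed.

(** Transposing a diagram reverses its boundary path and exchanges its two
    kinds of steps; in terms of Maya diagrams it is reflection followed by
    complement. *)
Lemma maya_conj mu k :
  (k \in adm_set (maya (conj_part mu))) = (flip k \notin adm_set (maya mu)).
Proof.
apply/idP/idP => [|/negP kA].
  rewrite !in_maya => /asboolP[j ->]; apply/asboolPn; case=> i.
  rewrite /flip /bead nth_conj.
  have := count_part_gt mu i j; case: (ltnP i) => ?; case: (ltnP j) => ? // _.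
    by lia.
  by lia.
have ne i : bead mu i != flip k.
  by apply/eqP => e; apply: kA; rewrite -e in_maya_bead.
have ex : exists i, bead mu i < flip k.
  exists (size mu + absz (flip k))%N; rewrite /bead nth_default; lia.
(* i0 is the number of beads above flip k: the height of the column sought. *)
case: (ex_minnP ex) => i0 lt0 min.
have nn : 0 <= flip k + i0%:Z by move: lt0; rewrite /bead; lia.
case e : (flip k + i0%:Z) nn => [j|] // _.
have cj : count (fun x => (j < x)%N) mu = i0.
  apply/eqP; rewrite eqn_leq [X in _ && X]leqNgt; apply/andP; split.
    by rewrite leqNgt count_part_gt; move: lt0; rewrite /bead; lia.
  case: i0 {lt0} min e => // i min e; rewrite ltnS -ltnNge count_part_gt.
  have := ne i; have : ~~ (bead mu i < flip k).
    by apply/negP => /min; rewrite ltnn.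
  rewrite /bead; lia.
rewrite in_maya; apply/asboolP; exists j; rewrite /bead nth_conj cj.
by move: e; rewrite /flip; lia.
Qed.

Lemma beads_conj N mu : (size mu <= N)%N -> (head 0 mu <= N)%N ->
  beads N (conj_part mu) = [seq k <- window N | flip k \notin adm_set (maya mu)].
Proof.
move=> sN hN; rewrite beads_window.
- by apply: eq_filter => k; rewrite maya_conj.
- by rewrite size_mkseq.
rewrite -nth0 nth_conj; apply: leq_trans sN; exact: count_size.
Qed.

Lemma beads_flip N mu : (size mu <= N)%N -> (head 0 mu <= N)%N ->
  map flip (beads N mu)
  = rev [seq k <- window N | flip k \in adm_set (maya mu)].
Proof.
move=> sN hN; rewrite beads_window // -filter_rev -flip_window filter_map.
by congr map; apply: eq_filter => k; rewrite /= flipK.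
Qed.

(** The beads of the conjugate and the reflected beads of the partition share
    out the window. *)
Lemma sum_beads_conj N mu (f : int -> int) :
  (size mu <= N)%N -> (head 0 mu <= N)%N ->
  \sum_(k <- beads N (conj_part mu)) f k + \sum_(k <- beads N mu) f (flip k)
  = \sum_(k <- window N) f k.
Proof.
move=> sN hN; rewrite -(big_map flip xpredT f) beads_flip // beads_conj //.
rewrite (perm_big _ (permEl (perm_rev _))) !big_filter /=.
by rewrite [RHS](bigID (fun k => flip k \notin adm_set (maya mu))) /=;
  congr (_ + _); apply: eq_bigl => k; rewrite negbK.
Qed.

Lemma sum_beads N mu (f : int -> int) :
  \sum_(k <- beads N mu) f k = \sum_(i < N) f (bead mu i).
Proof.
by rewrite big_map -(big_mkord xpredT (fun i => f (bead mu i))) /index_iota subn0.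
Qed.

(** Parts beyond the length contribute nothing, which lets sums over the rows
    be compared with sums over N beads. *)
Lemma sum_parts N mu (f : nat -> nat -> int) : (forall i, f i 0 = 0) ->
  (size mu <= N)%N ->
  \sum_(i < size mu) f i (nth 0%N mu i) = \sum_(i < N) f i (nth 0%N mu i).
Proof.
move=> f0 sN; rewrite (big_ord_widen N (fun i => f i (nth 0%N mu i))) //.
rewrite big_mkcond; apply: eq_bigr => i _ /=.
by case: ltnP => // h; rewrite nth_default.
Qed.

(** With b = mu_i - i, mu_i (mu_i - 2i + 1) = b (b + 1) - (-i) (-i + 1). *)
Lemma kappa_beads N mu : (size mu <= N)%N ->
  kappa mu = \sum_(k <- beads N mu) k * (k + 1)
             - \sum_(k <- beads N empty_part) k * (k + 1).
Proof.
move=> sN; rewrite /kappa.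
rewrite (sum_parts (f := fun i p => p%:Z * (p%:Z - 2%:Z * i.+1%:Z + 1))
  (fun i => mul0r _) sN) //.
rewrite !sum_beads -sumrB; apply: eq_bigr => i _; rewrite /bead nth_nil; lia.
Qed.

Lemma psize_beads N mu : (size mu <= N)%N ->
  (psize mu)%:Z = \sum_(k <- beads N mu) k - \sum_(k <- beads N empty_part) k.
Proof.
move=> sN; rewrite /psize sumnE (big_nth 0%N) big_mkord.
rewrite (big_morph Posz PoszD (erefl 0)).
rewrite (sum_parts (f := fun i p => p%:Z)
  (fun i => erefl _) sN) //.
rewrite !(sum_beads N _ id) -sumrB; apply: eq_bigr => i _; rewrite /bead nth_nil; lia.
Qed.

Lemma conj_empty_part : conj_part empty_part = empty_part.
Proof. exact: val_inj. Qed.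

Lemma kappa_conj mu : kappa (conj_part mu) = - kappa mu.
Proof.
pose N := maxn (size mu) (head 0 mu)%N.
have sN : (size mu <= N)%N by rewrite leq_maxl.
have hN : (head 0 mu <= N)%N by rewrite leq_maxr.
rewrite !(@kappa_beads N) ?size_mkseq //.
have e (k : int) : k * (k + 1) = flip k * (flip k + 1) by rewrite /flip; lia.
have := sum_beads_conj (fun k => k * (k + 1)) sN hN.
have := @sum_beads_conj N empty_part (fun k => k * (k + 1)) isT isT.
rewrite conj_empty_part.
have ef la : \sum_(k <- beads N la) flip k * (flip k + 1)
  = \sum_(k <- beads N la) k * (k + 1) by apply: eq_bigr.
rewrite /= !ef; move: (\sum_(k <- beads N empty_part) _) (\sum_(k <- window N) _)
  (\sum_(k <- beads N (conj_part mu)) _) (\sum_(k <- beads N mu) _) => *; lia.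
Qed.

Lemma psize_conj mu : psize (conj_part mu) = psize mu.
Proof.
pose N := maxn (size mu) (head 0 mu)%N.
have sN : (size mu <= N)%N by rewrite leq_maxl.
have hN : (head 0 mu <= N)%N by rewrite leq_maxr.
have := @psize_beads N (conj_part mu); rewrite size_mkseq => /(_ hN).
have := psize_beads sN.
have := sum_beads_conj id sN hN.
have := @sum_beads_conj N empty_part id isT isT.
rewrite conj_empty_part.
have ef la : \sum_(k <- beads N la) flip k
    = \sum_(k <- beads N empty_part) (- 1) - \sum_(k <- beads N la) k.
  by rewrite !(sum_beads N _ (fun=> - 1)) !(sum_beads N _ id) sum_beads sumrB.
rewrite /= !ef; move: (\sum_(k <- beads N empty_part) (-1)) => z.
move: (\sum_(k <- beads N empty_part) _) (\sum_(k <- window N) _)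
  (\sum_(k <- beads N (conj_part mu)) _) (\sum_(k <- beads N mu) _) => *; lia.
Qed.

End Beads.

(** * The determinant attached to a pair of partitions *)

Section StateDeterminant.
Variables (K : fieldType) (N : nat) (G : int -> int -> K) (f : bool -> int -> K).

(** The row of the mode x in the column c.  The factor (-1)^(k+1) of the unit
    rows is there to absorb the sign of the column shuffle in [rdet_state]. *)
Definition state_entry (x : bool * int) (c : int) : K :=
  f x.1 x.2 *
  (if x.1 then (-1) ^ (x.2 + 1) * (c == flip x.2)%:R else G x.2 c).

Definition state_row (x : bool * int) : 'rV[K]_(N + N) :=
  \row_j state_entry x (nth 0 (window N) j).

Definition state_seq (A B : seq int) : seq (bool * int) :=
  map (pair false) A ++ map (pair true) B.

Lemma shuffle_count_desc (P : pred int) lo n :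
  (-1) ^+ shuffle_count P (desc lo n)
  = \prod_(c <- desc lo n | ~~ P c) (-1) ^ (c - lo) :> K.
Proof.
elim: n => [|n IH] /=; first by rewrite big_nil.
rewrite big_cons; case: (P _) => //=.
by rewrite exprD IH size_desc addrAC subrr add0r.
Qed.

Hypothesis N_even : ~~ odd N.

(** For N even, moving the column flip k costs the sign (-1)^(N - 1 - k) =
    (-1)^(k + 1). *)
Lemma shuffle_count_window (nu : intpart) : (size nu <= N)%N -> (head 0 nu <= N)%N ->
  (-1) ^+ shuffle_count (fun c => flip c \notin adm_set (maya nu)) (window N)
  = \prod_(k <- beads N nu) (-1) ^ (k + 1) :> K.
Proof.
move=> sN hN; rewrite shuffle_count_desc.
under eq_bigl do rewrite negbK.
rewrite -big_filter -(perm_big _ (permEl (perm_rev _))) /=.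
rewrite -beads_flip // big_map; apply: eq_bigr => k _.
have -> : flip k - - N%:Z = N%:Z - (k + 1) by rewrite /flip; lia.
rewrite expfzDr ?oppr_eq0 ?oner_eq0 // -exprnP -signr_odd (negbTE N_even) mul1r.
by rewrite -exprz_inv invrN1.
Qed.

(** Order the columns as the beads of the conjugate of nu, then the reflected
    beads of nu in the order of the unit rows.  The matrix becomes block
    triangular with a diagonal lower right block, and [rdet_shuffle] gives the
    sign of the reordering, which the signs of the unit rows cancel. *)
Lemma rdet_state (mu nu : intpart) x0 :
  (size mu <= N)%N -> (size nu <= N)%N -> (head 0 nu <= N)%N ->
  rdet x0 state_row (state_seq (beads N mu) (beads N nu))
  = (\prod_(k <- beads N mu) f false k) * (\prod_(k <- beads N nu) f true k)
    * \det (\matrix_(i < N, j < N) G (bead mu i) (bead (conj_part nu) j)).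
Proof.
move=> smu snu hnu.
pose y i := nth x0 (state_seq (beads N mu) (beads N nu)) i.
pose C c : 'rV[K]_(N + N) := \row_i state_entry (y i) c.
have -> : rdet x0 state_row (state_seq (beads N mu) (beads N nu))
    = rdet 0 C (window N).
  by rewrite /rdet -det_tr; congr (\det _); apply/matrixP => i j; rewrite !mxE.
pose P c := flip c \notin adm_set (maya nu).
pose sg : K := \prod_(k <- beads N nu) (-1) ^ (k + 1).
have sg2 : sg * sg = 1.
  rewrite /sg -big_split big1_seq //= => k _.
  by rewrite -expfzMl mulrNN mulr1 exp1rz.
have -> : rdet 0 C (window N)
    = sg * rdet 0 C (beads N (conj_part nu) ++ map flip (beads N nu)).
  rewrite beads_conj // beads_flip //.
  have -> : [seq k <- window N | flip k \in adm_set (maya nu)]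
      = seq.filter (predC P) (window N).
    by apply: eq_filter => k; rewrite /P /= negbK.
  rewrite -/P rdet_shuffle ?size_window // (shuffle_count_window snu hnu) mulrA.
  by rewrite -/sg sg2 mul1r.
rewrite /rdet.
set A := (X in \det X).
have cl (i : 'I_(N + N)) (j : 'I_N) : i = lshift N j ->
  nth 0 (beads N (conj_part nu) ++ map flip (beads N nu)) i
    = bead (conj_part nu) j.
  by move=> ->; rewrite nth_cat size_mkseq /= ltn_ord nth_mkseq.
have cr (i : 'I_(N + N)) (j : 'I_N) : i = rshift N j ->
  nth 0 (beads N (conj_part nu) ++ map flip (beads N nu)) i = flip (bead nu j).
  move=> ->; rewrite nth_cat size_mkseq /= ltnNge leq_addr /= addKn.
  by rewrite (nth_map 0) ?size_mkseq // nth_mkseq.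
have yl (i : 'I_(N + N)) (j : 'I_N) : i = lshift N j -> y i = (false, bead mu j).
  move=> ->; rewrite /y nth_cat size_map size_mkseq /= ltn_ord.
  by rewrite (nth_map 0) ?size_mkseq // nth_mkseq.
have yr (i : 'I_(N + N)) (j : 'I_N) : i = rshift N j -> y i = (true, bead nu j).
  move=> ->; rewrite /y nth_cat size_map size_mkseq /= ltnNge leq_addr /= addKn.
  by rewrite (nth_map 0) ?size_mkseq // nth_mkseq.
have -> : A = block_mx
    (\matrix_(i < N, j < N) G (bead mu j) (bead (conj_part nu) i)
       *m diag_mx (\row_j f false (bead mu j))) 0
    (dlsubmx A) (diag_mx (\row_j (f true (bead nu j) * (-1) ^ (bead nu j + 1)))).
  rewrite -[LHS]submxK; congr block_mx; apply/matrixP => i j; rewrite !mxE.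
  - rewrite (cl _ i) // (yl _ j) // (bigD1 j) //= big1 => [|k kj].
      by rewrite !mxE eqxx addr0 mulrC.
    by rewrite !mxE (negbTE kj) mulr0.
  - rewrite (cl _ i) // (yr _ j) // /state_entry /=.
    case: eqP => [e|]; last by rewrite !mulr0.
    have := in_maya_bead (conj_part nu) i.
    by rewrite maya_conj e flipK in_maya_bead.
  - rewrite (cr _ i) // (yr _ j) // /state_entry /=.
    rewrite (inj_eq (can_inj flipK)) (inj_eq (@bead_inj nu)) val_eqE.
    by case: eqP => [->|_]; rewrite ?mulr0 ?mulr1.
rewrite det_lblock det_mulmx !det_diag.
have prod_beads la (g : int -> K) :
    \prod_(k <- beads N la) g k = \prod_(i < N) g (bead la i).
  rewrite big_map -(big_mkord xpredT (fun i => g (bead la i))).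
  by rewrite /index_iota subn0.
under [\prod_i (\row_j (f true _ * _)) _ _]eq_bigr do rewrite mxE.
under [\prod_i (\row_j f false _) _ _]eq_bigr do rewrite mxE.
rewrite big_split /= -(prod_beads mu (f false)) -(prod_beads nu (f true)).
rewrite -(prod_beads nu (fun k => (-1) ^ (k + 1))) -/sg -[in RHS]det_tr.
have -> : (\matrix_(i < N, j < N) G (bead mu i) (bead (conj_part nu) j))^T
    = \matrix_(i, j) G (bead mu j) (bead (conj_part nu) i).
  by apply/matrixP => i j; rewrite !mxE.
move: (\prod_(k <- _) f false k) (\prod_(k <- _) f true k) (\det _) => a b d.
by rewrite -[RHS]mul1r -sg2; clearbody sg; ring.
Qed.

End StateDeterminant.

(** * Fermions on pairs of admissible sets *)

Lemma fsum_single (V : nmodType) (I : choiceType) (F : I -> V) i0 :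
  (forall i, i != i0 -> F i = 0) -> \sum_(i \in [set: I]%classic) F i = F i0.
Proof.
move=> F0; rewrite (fsbigTE [fset i0]%fset) ?big_seq_fset1 // => i.
by rewrite inE; exact: F0.
Qed.

Section FockStates.
Implicit Types (A : adm) (S : adm * adm) (x y : bool * int) (k : int).

(** The tensor factors are indexed by false (first) and true (second), and a
    mode of the product is a pair of such an index and an integer. *)
Definition component S (i : bool) : adm := if i then S.2 else S.1.

Definition occupied S x : bool := x.2 \in adm_set (component S x.1).

Definition del_state S x : adm * adm :=
  if x.1 then (S.1, adm_del S.2 x.2) else (adm_del S.1 x.2, S.2).

Definition add_state S x : adm * adm :=
  if x.1 then (S.1, adm_add S.2 x.2) else (adm_add S.1 x.2, S.2).

Lemma in_adm_add A k j : (j \in adm_set (adm_add A k)) = (j \in adm_set A) || (j == k).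
Proof.
apply/idP/orP; rewrite !inE /=; last by case=> [?|/eqP]; [left|right].
by case=> [?|->]; [left|right].
Qed.

Lemma in_adm_del A k j : (j \in adm_set (adm_del A k)) = (j \in adm_set A) && (j != k).
Proof.
apply/idP/andP; rewrite !inE /=.
  by case=> ? jk; split; last exact/eqP.
by case=> ? /eqP.
Qed.

Lemma adm_eqP A B : (forall j, (j \in adm_set A) = (j \in adm_set B)) -> A = B.
Proof.
move=> e; apply: val_inj; apply/seteqP; split=> j /=.
  by move=> Aj; apply/set_mem; rewrite -e; exact/mem_set.
by move=> Bj; apply/set_mem; rewrite e; exact/mem_set.
Qed.

Lemma adm_delK A k : k \in adm_set A -> adm_add (adm_del A k) k = A.
Proof.
move=> kA; apply: adm_eqP => j; rewrite in_adm_add in_adm_del.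
by case: eqP => [->|_]; rewrite ?kA ?andbT ?orbF ?orbT.
Qed.

Lemma adm_addK A k : k \notin adm_set A -> adm_del (adm_add A k) k = A.
Proof.
move=> kA; apply: adm_eqP => j; rewrite in_adm_del in_adm_add.
by case: eqP => [->|_]; rewrite ?(negbTE kA) ?andbT ?orbF ?andbF.
Qed.

Lemma occupied_del S x y : occupied (del_state S x) y = occupied S y && (y != x).
Proof.
case: x => i k; case: y => i' j; case: i; case: i'; rewrite /occupied /del_state /= ?in_adm_del ?andbT //.
Qed.

Lemma occupied_add S x y : occupied (add_state S x) y = occupied S y || (y == x).
Proof.
case: x => i k; case: y => i' j; case: i; case: i'; rewrite /occupied /add_state /= ?in_adm_add ?orbF //.
Qed.

Lemma n_above_ext A B k : (forall j, k < j -> (j \in adm_set A) = (j \in adm_set B)) ->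
  n_above k A = n_above k B.
Proof.
move=> e; rewrite /n_above; congr (#|` fset_set _ |%fset); apply/seteqP.
split=> j [] jA /= kj; split=> //; apply/set_mem.
  by rewrite -e //; exact/mem_set.
by rewrite e //; exact/mem_set.
Qed.

End FockStates.

Section Operators.
Variable K : fieldType.
Implicit Types (S : adm * adm) (x : bool * int) (v : fvec K (adm * adm)).

(** The sign of psi or psi* at the mode x, including the Koszul sign of the
    second factor.  It is the same whether it is read off a state with or
    without x. *)
Definition fermion_sign S x : K :=
  (if x.1 then (-1) ^ charge S.1 else 1)
  * (-1) ^+ n_above x.2 (component S x.1).

Lemma psiE k A B : psi K k A B =
  ((k \notin adm_set A) && (B == adm_add A k))%:R * (-1) ^+ n_above k A.
Proof. by rewrite /psi; case: ifP => _ /=; rewrite ?mul0r // mulrC. Qed.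

Lemma psi_starE k A B : psi_star K k A B =
  ((k \in adm_set A) && (B == adm_del A k))%:R * (-1) ^+ n_above k A.
Proof.
rewrite /psi_star; case: ifP => _ /=; rewrite ?mul0r //.
by rewrite mulrC !exprS !mulN1r opprK.
Qed.

(** A basis vector has at most one preimage under a creation operator, so the
    sum that defines the operator has a single term. *)
Lemma psi2E i k v S : psi2 i k v S =
  if occupied S (i, k) then fermion_sign S (i, k) * v (del_state S (i, k)) else 0.
Proof.
rewrite /psi2 /lin_ext (fsum_single (i0 := del_state S (i, k))).
  rewrite /on_factor /tensor /fermion_sign /basis /occupied /del_state /=.
  case: i => /=; rewrite psiE in_adm_del !eqxx andbF /= ?mulr1 mul1r.
    case: ifP => kA; last first.
      case: eqP => e; last by rewrite !(mul0r, mulr0).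
      by move: kA; rewrite e in_adm_add eqxx orbT.
    rewrite adm_delK // eqxx !mul1r mulrC; congr (_ * _ * _).
    by congr (_ ^+ _); apply: n_above_ext => j kj; rewrite in_adm_del gt_eqF ?andbT.
  case: ifP => kA; last first.
    case: eqP => e; last by rewrite !(mul0r, mulr0).
    by move: kA; rewrite e in_adm_add eqxx orbT.
  rewrite adm_delK // eqxx !mul1r mulrC; congr (_ * _).
  by congr (_ ^+ _); apply: n_above_ext => j kj; rewrite in_adm_del gt_eqF ?andbT.
move=> [A B]; rewrite /on_factor /tensor /basis /del_state /=; case: i => /=;
  rewrite psiE; case: S => SA SB /=; rewrite xpair_eqE negb_and.
  rewrite [A == SA]eq_sym; case: (SA =P A) => _; last by rewrite ?mul0r !mulr0.
  rewrite /= mul1r; case: (boolP (_ && _)) => [/andP[kA /eqP->]|_].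
    by rewrite adm_addK // eqxx.
  by rewrite mul0r !mulr0.
rewrite [B == SB]eq_sym; case: (SB =P B) => _; last by rewrite !mulr0.
rewrite /= orbF mulr1; case: (boolP (_ && _)) => [/andP[kA /eqP->]|_].
  by rewrite adm_addK // eqxx.
by rewrite mul0r !mulr0.
Qed.

Lemma psi2_starE i k v S : psi2_star i k v S =
  if occupied S (i, k) then 0 else fermion_sign S (i, k) * v (add_state S (i, k)).
Proof.
rewrite /psi2_star /lin_ext (fsum_single (i0 := add_state S (i, k))).
  rewrite /on_factor /tensor /fermion_sign /basis /occupied /add_state /=.
  case: i => /=; rewrite psi_starE in_adm_add !eqxx orbT /= ?mulr1 mul1r.
    case: ifP => kA.
      case: eqP => e; last by rewrite !(mul0r, mulr0).
      by move: kA; rewrite e in_adm_del eqxx andbF.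
    rewrite adm_addK ?kA // eqxx !mul1r mulrC; congr (_ * _ * _).
    by congr (_ ^+ _); apply: n_above_ext => j kj; rewrite in_adm_add gt_eqF ?orbF.
  case: ifP => kA.
    case: eqP => e; last by rewrite !(mul0r, mulr0).
    by move: kA; rewrite e in_adm_del eqxx andbF.
  rewrite adm_addK ?kA // eqxx !mul1r mulrC; congr (_ * _).
  by congr (_ ^+ _); apply: n_above_ext => j kj; rewrite in_adm_add gt_eqF ?orbF.
move=> [A B]; rewrite /on_factor /tensor /basis /add_state /=; case: i => /=;
  rewrite psi_starE; case: S => SA SB /=; rewrite xpair_eqE negb_and.
  rewrite [A == SA]eq_sym; case: (SA =P A) => _; last by rewrite ?mul0r !mulr0.
  rewrite /= mul1r; case: (boolP (_ && _)) => [/andP[kA /eqP->]|_].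
    by rewrite adm_delK // eqxx.
  by rewrite mul0r !mulr0.
rewrite [B == SB]eq_sym; case: (SB =P B) => _; last by rewrite !mulr0.
rewrite /= orbF mulr1; case: (boolP (_ && _)) => [/andP[kA /eqP->]|_].
  by rewrite adm_delK // eqxx.
by rewrite mul0r !mulr0.
Qed.

End Operators.

(** * Fermionic signs inside a finite window *)

Section FockWindow.
Variables (N : nat).
Hypothesis N_even : ~~ odd N.
Implicit Types (A : adm) (S : adm * adm) (x y : bool * int) (k : int).

(** The total order of the modes that governs the signs: the first factor
    before the second, and decreasing in each of them. *)
Definition window_modes : seq (bool * int) := state_seq (window N) (window N).

Definition occ_seq S : seq (bool * int) := [seq x <- window_modes | occupied S x].

(** The state is that of the vacuum outside of the window, so it is known from
    its finite list of occupied modes in the window. *)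
Definition confined S : Prop :=
  (forall i k, k < - N%:Z -> occupied S (i, k))
  /\ (forall i k, occupied S (i, k) -> k < N%:Z).

Lemma mem_state_seq (s1 s2 : seq int) i k :
  ((i, k) \in state_seq s1 s2) = (k \in if i then s2 else s1).
Proof.
rewrite mem_cat; have inj b : injective (@pair bool int b) by move=> ? ? [].
have no b c s : b != c -> (b, k) \in map (pair c) s = false.
  by move=> bc; apply/mapP => -[j _] [e _]; rewrite e eqxx in bc.
by case: i; rewrite (mem_map (inj _)) no // orbF.
Qed.

Lemma mem_window_modes i k : ((i, k) \in window_modes) = (- N%:Z <= k) && (k < N%:Z).
Proof. by rewrite mem_state_seq if_same mem_window. Qed.

Lemma window_modes_uniq : uniq window_modes.
Proof.
rewrite cat_uniq !map_inj_uniq ?desc_uniq ?andbT /=; try by move=> ? ? [].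
by apply/hasPn => _ /mapP[k _ ->]; apply/mapP => -[].
Qed.

Lemma card_fset_set (s : seq int) (X : set int) : uniq s ->
  (forall k, (k \in X) = (k \in s)) -> #|` fset_set X |%fset = size s.
Proof.
move=> us e; have -> : X = [set` [fset k in s]%fset]%classic.
  apply/seteqP; split=> k /=.
    by move=> Xk; rewrite inE -e; exact/mem_set.
  by rewrite inE -e => /set_mem.
by rewrite set_fsetK card_fseq undup_id.
Qed.

Lemma window_split k : - N%:Z <= k -> k < N%:Z ->
  exists r1 r2, window N = r1 ++ k :: r2
    /\ (forall j, (j \in r1) = (k < j) && (j < N%:Z)).
Proof.
move=> k1 k2; have : k \in window N by rewrite mem_window k1.
have memw := mem_window N; have := desc_sorted (- N%:Z) (N + N).
rewrite -/(window N); move=> ws kw; case/splitPr: kw ws memw => r1 r2 ws memw.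
exists r1, r2; split=> // j.
move: ws; rewrite (sorted_pairwise gtz_trans) pairwise_cat /= => /andP[/allP a1].
case/andP=> _ /andP[/allP a2 _].
apply/idP/andP => [jr|[kj jN]].
  have := memw j; rewrite mem_cat jr => /esym/andP[_ ->]; split=> //.
  by have /= /andP[] := a1 j jr.
have := memw j; rewrite mem_cat inE jN andbT.
have -> : - N%:Z <= j by lia.
case/orP => // /orP[/eqP e|/a2 /=]; lia.
Qed.

Lemma n_above_count A r1 k : (forall j, j \in adm_set A -> j < N%:Z) ->
  uniq r1 -> (forall j, (j \in r1) = (k < j) && (j < N%:Z)) ->
  n_above k A = size [seq j <- r1 | j \in adm_set A].
Proof.
move=> hi ur e; apply: card_fset_set; first exact: filter_uniq.
move=> j; rewrite mem_filter e; apply/idP/andP => [/set_mem[jA kj]|].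
  by rewrite (mem_set jA) hi ?andbT; [split|exact: mem_set].
by case=> /set_mem jA /andP[kj _]; apply/mem_set; split.
Qed.

(** The charge of a confined set differs by N from the number of its elements
    in the window. *)
Lemma charge_count A : (forall j, j \in adm_set A -> j < N%:Z) ->
  (forall j, j < - N%:Z -> j \in adm_set A) ->
  charge A = (size [seq j <- window N | j \in adm_set A])%:Z - N%:Z.
Proof.
move=> hi lo; rewrite /charge.
rewrite (@card_fset_set [seq j <- window N | (j \in adm_set A) && (0 <= j)]);
  last 2 first.
- by apply: filter_uniq; exact: desc_uniq.
- move=> j; rewrite mem_filter mem_window; apply/idP/andP => [/set_mem[jA j0]|].
    rewrite (mem_set jA) /= in j0 *; rewrite j0 (hi j) ?andbT; last exact: mem_set.
    by split=> //; lia.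
  by case=> /andP[/set_mem jA j0] _; apply/mem_set; split.
rewrite (@card_fset_set [seq j <- window N | (j \notin adm_set A) && (j < 0)]);
  last 2 first.
- by apply: filter_uniq; exact: desc_uniq.
- move=> j; rewrite mem_filter mem_window; apply/idP/andP => [/set_mem[/= j0 jA]|].
    rewrite j0 andbT; split; first by apply/negP => /set_mem.
    have -> : - N%:Z <= j by rewrite leNgt; apply/negP => /lo /set_mem.
    rewrite /=; lia.
  by case=> /andP[/negP jA j0] _; apply/mem_set; split=> // /mem_set.
have sz : size [seq j <- window N | j < 0] = N.
  have -> : [seq j <- window N | j < 0] = desc (- N%:Z) N.
    apply: (irr_sorted_eq gtz_trans ltxx _ (desc_sorted _ _)).
      by apply: sorted_filter (desc_sorted _ _); exact: gtz_trans.
    by move=> j; rewrite mem_filter mem_window mem_desc; lia.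
  exact: size_desc.
rewrite -[X in _ = _ - Posz X]sz !size_filter.
elim: (window N) {hi lo sz} => //= j w; rewrite (ltNge j 0).
by case: (j \in adm_set A); case: (0 <= j) => /=; lia.
Qed.

(** For N even the Koszul sign (-1)^charge is the parity of the number of
    modes of the first factor in the window.  So for both factors the sign
    counts the occupied modes that precede x in the order of [window_modes].
    *)
Lemma fermion_sign_count (K : fieldType) x : x \in window_modes ->
  exists l1 l2, window_modes = l1 ++ x :: l2
    /\ forall S, confined S ->
       fermion_sign K S x = (-1) ^+ size [seq y <- l1 | occupied S y].
Proof.
case: x => i k; rewrite mem_window_modes => /andP[k1 k2].
have [r1 [r2 [e mr]]] := window_split k1 k2.
have ur : uniq r1.
  by have := desc_uniq (- N%:Z) (N + N); rewrite -/(window N) e cat_uniq => /andP[].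
have occ_map S b r : size [seq y <- map (pair b) r | occupied S y]
    = size [seq j <- r | j \in adm_set (component S b)].
  by rewrite filter_map size_map.
case: i.
  exists (map (pair false) (window N) ++ map (pair true) r1), (map (pair true) r2).
  split; first by rewrite -catA; congr (_ ++ _); rewrite e map_cat.
  move=> S [lo hi]; rewrite filter_cat size_cat !occ_map /fermion_sign /=.
  rewrite (n_above_count (r1 := r1)) //; last by move=> j; exact: (hi true j).
  rewrite charge_count; [|exact: (hi false)|exact: (lo false)].
  rewrite expfzDr ?oppr_eq0 ?oner_eq0 // exprD; congr (_ * _).
  by rewrite -exprz_inv invrN1 -!exprnP -[X in _ * X]signr_odd (negbTE N_even) mulr1.
exists (map (pair false) r1), (map (pair false) r2 ++ map (pair true) (window N)).
split; first by rewrite /window_modes /state_seq {1}e map_cat -catA.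
move=> S [lo hi]; rewrite !occ_map /fermion_sign /= mul1r.
by rewrite (n_above_count (r1 := r1)) //; move=> j; exact: (hi false j).
Qed.

End FockWindow.

(** * The exponential of a bilinear operator *)

(** The exponent of T for an arbitrary array of coefficients. *)
Definition bilinear (K : fieldType) (a : bool -> bool -> nat -> nat -> K)
    (v : fvec K (adm * adm)) : fvec K (adm * adm) :=
  fun S => \sum_(i : bool) \sum_(j : bool) \sum_(mn \in [set: nat * nat]%classic)
    a i j mn.1 mn.2 * psi2 i (Posz mn.1) (psi2_star j (Negz mn.2) v) S.

Section Wick.
Variables (K : fieldType) (N : nat).
Hypothesis N_even : ~~ odd N.
Variable a : bool -> bool -> nat -> nat -> K.
Variable Y : bool * int -> 'rV[K]_(N + N).
Hypothesis Y_rel : forall i (m : nat), (m < N)%N ->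
  Y (i, Posz m) = \sum_(j : bool) \sum_(n < N) a i j m n *: Y (j, Negz n).
Implicit Types (S : adm * adm) (x y : bool * int) (v : fvec K (adm * adm)).

Local Notation D := (rdet (false, 0) Y).
Local Notation vac := (maya empty_part, maya empty_part).

(** The number of occupied modes m + 1/2 in the two factors. *)
Definition particles S : nat := \sum_(i : bool) \sum_(m < N) occupied S (i, Posz m).

Lemma confined_del S i m : confined N S -> confined N (del_state S (i, Posz m)).
Proof.
move=> [lo hi]; split=> j k; rewrite occupied_del.
  move=> kN; rewrite lo //=; apply/eqP => -[_ e]; move: kN; rewrite e; lia.
by case/andP=> /hi.
Qed.

Lemma confined_add S i n : (n < N)%N -> confined N S -> confined N (add_state S (i, Negz n)).
Proof.
move=> nN [lo hi]; split=> j k; rewrite occupied_add.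
  by move=> kN; rewrite lo.
by case/orP=> [/hi //|/eqP[_ ->]]; lia.
Qed.

Lemma particles_add S i n : particles (add_state S (i, Negz n)) = particles S.
Proof.
apply: eq_bigr => j _; apply: eq_bigr => m _; congr nat_of_bool.
by rewrite occupied_add xpair_eqE andbF orbF.
Qed.

Lemma particles_del S i (m : 'I_N) : occupied S (i, Posz m) ->
  particles S = (particles (del_state S (i, Posz m))).+1.
Proof.
move=> om; rewrite /particles !pair_big /=.
rewrite (bigD1 (i, m)) //= om [in RHS](bigD1 (i, m)) //=.
rewrite occupied_del eqxx andbF add0n add1n; congr _.+1.
apply: eq_bigr => -[j k] jk; congr nat_of_bool.
by rewrite occupied_del /= -[X in _ && X]/(_ != _) (_ : (j, Posz k) != _) ?andbT.
Qed.

(** Deleting an occupied mode cuts it out of the list of occupied modes, and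
    its fermionic sign is the parity of the number of entries before it. *)
Lemma occ_seq_del S x : x \in window_modes N -> occupied S x ->
  exists s1 s2, [/\ occ_seq N S = s1 ++ x :: s2,
    occ_seq N (del_state S x) = s1 ++ s2,
    confined N S -> fermion_sign K S x = (-1) ^+ size s1
    & confined N (del_state S x) ->
      fermion_sign K (del_state S x) x = (-1) ^+ size s1].
Proof.
move=> xw ox; have [l1 [l2 [e sgn]]] := fermion_sign_count N_even K xw.
exists [seq y <- l1 | occupied S y], [seq y <- l2 | occupied S y].
have := window_modes_uniq N; rewrite e cat_uniq /=.
case/and3P=> _ /norP[nx1 _] /andP[nx2 _].
have f l : x \notin l ->
    [seq y <- l | occupied (del_state S x) y] = [seq y <- l | occupied S y].
  move=> nx; apply: eq_in_filter => y yl; rewrite occupied_del.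
  by have [e'|] := eqVneq y x; [rewrite -e' yl in nx|rewrite andbT].
split=> [|| /sgn //|/sgn ->].
- by rewrite /occ_seq e filter_cat /= ox.
- by rewrite /occ_seq e filter_cat /= occupied_del eqxx andbF !f.
- by rewrite f.
Qed.

Lemma add_stateK S x : ~~ occupied S x -> del_state (add_state S x) x = S.
Proof.
case: S x => A B [i k]; case: i; rewrite /occupied /del_state /add_state /= => ok;
by rewrite adm_addK.
Qed.

Lemma in_occ_seq S x : x \in window_modes N -> (x \in occ_seq N S) = occupied S x.
Proof. by rewrite mem_filter => ->; rewrite andbT. Qed.

Lemma particle_mode i (m : 'I_N) : (i, Posz m) \in window_modes N.
Proof. by rewrite mem_window_modes; have := ltn_ord m; lia. Qed.

Lemma hole_mode i (n : 'I_N) : (i, Negz n) \in window_modes N.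
Proof. by rewrite mem_window_modes; have := ltn_ord n; lia. Qed.

(** With 2N occupied modes in a window with 2N negative modes, a state without
    particles has no room for a hole. *)
Lemma particles0_vac S : confined N S -> size (occ_seq N S) = (N + N)%N ->
  particles S = 0%N -> S = vac.
Proof.
move=> [lo hi] sS p0.
have pos i k : 0 <= k -> ~~ occupied S (i, k).
  case: k => // m _; apply/negP => om; have mN : (m < N)%N by have := hi _ _ om; lia.
  move: p0; rewrite /particles pair_big /= (bigD1 (i, Ordinal mN)) //= om.
  by rewrite addSn.
pose neg := [seq x <- window_modes N | x.2 < 0].
have sneg : size neg = (N + N)%N.
  have f b : [seq x <- map (pair b) (window N) | x.2 < 0]
      = map (pair b) (desc (- N%:Z) N).
    rewrite filter_map; congr map.
    apply: (irr_sorted_eq gtz_trans ltxx _ (desc_sorted _ _)).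
      by apply: sorted_filter (desc_sorted _ _); exact: gtz_trans.
    by move=> j; rewrite mem_filter mem_window mem_desc /=; lia.
  by rewrite /neg filter_cat !f size_cat !size_map !size_desc.
have : all (occupied S) neg.
  rewrite all_count sneg -sS /occ_seq -size_filter /neg -filter_predI.
  apply/eqP; congr size; apply: eq_filter => -[i k] /=.
  by case: (ltrP k 0) => [|/(pos i)/negbTE ->]; rewrite ?andbT ?andbF.
move/allP => neg_occ.
have occ i k : occupied S (i, k) = (k < 0).
  case: (ltrP k 0) => [k0|/(pos i)/negbTE //].
  case: (ltrP k (- N%:Z)) => kN; first exact: lo.
  by apply: neg_occ; rewrite mem_filter /= k0 mem_window_modes kN /=; lia.
have mE k : (k \in adm_set (maya empty_part)) = (k < 0).
  rewrite in_maya; apply/asboolP/idP => [[i ->]|k0].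
    by rewrite /bead nth_nil; lia.
  by exists (absz (k + 1)); rewrite /bead nth_nil; lia.
case: S occ {neg neg_occ sneg pos lo hi sS p0} => A B occ.
by congr (_, _); apply: adm_eqP => k; rewrite mE; [exact: (occ false)|exact: (occ true)].
Qed.

(** Creating a particle outside of the window, or a hole outside of it, cannot
    lead to a confined state; the formal sum over all m and n is therefore
    finite. *)
Lemma bilinear_window v S : confined N S ->
  bilinear a v S = \sum_(i : bool) \sum_(m < N)
    (if occupied S (i, Posz m) then fermion_sign K S (i, Posz m) *
       \sum_(j : bool) \sum_(n < N)
          a i j m n * psi2_star j (Negz n) v (del_state S (i, Posz m)) else 0).
Proof.
move=> cS; apply: eq_bigr => i _.
transitivity (\sum_(j : bool) \sum_(m < N) \sum_(n < N)
    a i j m n * psi2 i (Posz m) (psi2_star j (Negz n) v) S).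
  apply: eq_bigr => j _; rewrite pair_big /=.
  pose h (mn : 'I_N * 'I_N) : nat * nat := (nat_of_ord mn.1, nat_of_ord mn.2).
  have hinj : injective h.
    by move=> [m n] [m' n'] [/val_inj -> /val_inj ->].
  rewrite (fsbigTE [fset h mn | mn in {: 'I_N * 'I_N}]%fset); last first.
    move=> [m n] mn; rewrite psi2E /=; case: ifP => om; last by rewrite mulr0.
    rewrite psi2_starE; case: ifP => on /=; first by rewrite !mulr0.
    have mN : (m < N)%N by have := (proj2 cS) _ _ om; rewrite /=; lia.
    have nN : (n < N)%N.
      rewrite ltnNge; apply/negP => nN; move: on.
      by rewrite (proj1 (confined_del i m cS)) //; lia.
    by move/imfsetP: mn; case; exists (Ordinal mN, Ordinal nN) => //.
  rewrite big_imfset /=; last by move=> ? ? _ _; exact: hinj.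
  by rewrite big_enum.
rewrite exchange_big; apply: eq_bigr => m _; case: ifP => om.
  rewrite mulr_sumr; apply: eq_bigr => j _.
  rewrite mulr_sumr; apply: eq_bigr => n _.
  by rewrite psi2E om mulrCA.
by apply: big1 => j _; apply: big1 => n _; rewrite psi2E om mulr0.
Qed.

(** Induction on k.  For a state S with a particle x, moving the row of x to
    the front and expanding it as the combination of the rows of hole modes y
    gives the determinants of S with x replaced by y; the terms with y already
    occupied have two equal rows.  Each of the k + 1 particles thus recovers
    the determinant of S from states with k particles, which accounts for the
    factor (k + 1)! = (k + 1) k!. *)
Lemma iter_bilinear k S : confined N S -> size (occ_seq N S) = (N + N)%N ->
  iter k (bilinear a) (ket2 K empty_part empty_part) S * D (occ_seq N vac)
  = (particles S == k)%:R * k`!%:R * D (occ_seq N S).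
Proof.
elim: k S => [|k IH] S cS sS.
  rewrite /= mulr1 /ket2 /tensor /basis.
  case: (particles S =P 0%N) => [p0|np0].
    by rewrite (particles0_vac cS sS p0) !eqxx !mul1r.
  case: (S.1 =P _) => [e1|_]; last by rewrite !mul0r.
  case: (S.2 =P _) => [e2|_]; last by rewrite mulr0 !mul0r.
  case: np0; rewrite /particles big1 // => i _; rewrite big1 // => m _.
  rewrite /occupied /component e1 e2 if_same in_maya; apply/eqP.
  by rewrite eqb0; apply/asboolPn => -[j]; rewrite /bead nth_nil /=; lia.
rewrite iterS bilinear_window //.
have step i (m : 'I_N) : occupied S (i, Posz m) ->
    fermion_sign K S (i, Posz m) *
    (\sum_(j : bool) \sum_(n < N) a i j m n *
        psi2_star j (Negz n)
          (iter k (bilinear a) (ket2 K empty_part empty_part))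
          (del_state S (i, Posz m))) * D (occ_seq N vac)
    = (particles S == k.+1)%:R * k`!%:R * D (occ_seq N S).
  move=> om; set S' := del_state S _.
  have cS' : confined N S' by exact: confined_del.
  have pS : particles S = (particles S').+1 by exact: particles_del.
  have [s1 [s2 [eS eS' sgn _]]] := occ_seq_del (particle_mode i m) om.
  have sS' : (size (occ_seq N S')).+1 = (N + N)%N.
    by rewrite -sS eS eS' !size_cat /= addnS.
  have hole j (n : 'I_N) : psi2_star j (Negz n)
        (iter k (bilinear a) (ket2 K empty_part empty_part)) S'
        * D (occ_seq N vac)
      = (particles S' == k)%:R * k`!%:R * D ((j, Negz n) :: occ_seq N S').
    rewrite psi2_starE; case: ifP => [on|/negbT on].
      by rewrite mul0r rdet_dup ?mulr0 ?in_occ_seq ?hole_mode.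
    have oa : occupied (add_state S' (j, Negz n)) (j, Negz n).
      by rewrite occupied_add eqxx orbT.
    have [t1 [t2 [eA eA' _ sgnA]]] := occ_seq_del (hole_mode j n) oa.
    rewrite add_stateK // in eA' sgnA.
    have sA : size (occ_seq N (add_state S' (j, Negz n))) = (N + N)%N.
      by rewrite eA size_cat /= addnS -size_cat -eA'.
    rewrite -mulrA IH //; last by apply: confined_add.
    rewrite particles_add sgnA // eA rdet_front -?eA // eA'.
    by rewrite mulrCA !mulrA -[_ * _ * (-1) ^+ _]mulrA -expr2 sqrr_sign mulr1.
  rewrite -mulrA mulr_suml.
  under eq_bigr => j _.
    rewrite mulr_suml.
    under eq_bigr => n _ do rewrite -mulrA hole mulrCA.
    rewrite -mulr_sumr; over.
  rewrite -mulr_sumr pS eqSS mulrCA; congr (_ * _).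
  rewrite (_ : \sum_j _ = D ((i, Posz m) :: occ_seq N S')).
    by rewrite sgn // eS rdet_front -?eS // eS'.
  rewrite pair_big /=.
  apply/esym.
  apply: (@rdet_linear _ _ _ _ _ _ _ (fun jn : bool * 'I_N => a i jn.1 m jn.2)
     (fun jn => (jn.1, Negz jn.2))) => //.
  by rewrite Y_rel // pair_big.
rewrite mulr_suml.
under eq_bigr => i _.
  rewrite mulr_suml.
  under eq_bigr => m _.
    rewrite (_ : _ * _ = (occupied S (i, Posz m))%:R *
      ((particles S == k.+1)%:R * k`!%:R * D (occ_seq N S))); last first.
      by case: ifP => [/step ->|_]; rewrite ?mul1r ?mul0r.
    over.
  rewrite -mulr_suml -natr_sum; over.
rewrite -mulr_suml -natr_sum -/(particles S) !mulrA; congr (_ * _).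
case: (particles S =P k.+1) => [->|_]; last by rewrite mulr0 !mul0r.
by rewrite mulr1 mul1r -natrM -factS.
Qed.

(** Only the power of the exponent equal to the number of particles of S
    reaches S, and 1/k! cancels the k! of [iter_bilinear]. *)
Lemma fexp_bilinear S : (forall n, n.+1%:R != 0 :> K) ->
  confined N S -> size (occ_seq N S) = (N + N)%N -> D (occ_seq N vac) != 0 ->
  fexp (bilinear a) (ket2 K empty_part empty_part) S
  = D (occ_seq N S) / D (occ_seq N vac).
Proof.
move=> char0 cS sS D0; rewrite /fexp (fsum_single (i0 := particles S)).
  apply: (mulIf D0); rewrite -mulrA iter_bilinear // eqxx mul1r mulrA divfK //.
  by rewrite mulVf ?mul1r //; case: _`! (fact_gt0 (particles S)).
move=> k kp; apply: (mulIf D0); rewrite -mulrA iter_bilinear //.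
by rewrite eq_sym (negbTE kp) !mul0r mulr0.
Qed.

End Wick.

Lemma confined_maya N (mu nu : intpart) :
  (size mu <= N)%N -> (head 0 mu <= N)%N -> (size nu <= N)%N -> (head 0 nu <= N)%N ->
  confined N (maya mu, maya nu).
Proof.
by move=> *; split=> -[] k; rewrite /occupied /component /=;
  [exact: maya_low|exact: maya_low|exact: maya_high|exact: maya_high].
Qed.

Lemma occ_seq_maya N (mu nu : intpart) :
  (size mu <= N)%N -> (head 0 mu <= N)%N -> (size nu <= N)%N -> (head 0 nu <= N)%N ->
  occ_seq N (maya mu, maya nu) = state_seq (beads N mu) (beads N nu).
Proof.
move=> *; rewrite /occ_seq /window_modes filter_cat !filter_map !beads_window //.
Qed.

(** * Cauchy-Binet and sums over partitions *)

Section CauchyBinet.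
Variables (K : comNzRingType) (n p : nat).

Definition increasing (f : {ffun 'I_n -> 'I_p}) : bool :=
  [forall i : 'I_n, forall j : 'I_n, (i < j)%N ==> (f i < f j)%N].

Lemma increasingP (f : {ffun 'I_n -> 'I_p}) :
  reflect (forall i j : 'I_n, (i < j)%N -> (f i < f j)%N) (increasing f).
Proof.
apply: (iffP forallP) => [mf i j|mf i]; first by move/forallP: (mf i) => /(_ j)/implyP.
by apply/forallP => j; apply/implyP; exact: mf.
Qed.

Lemma increasing_inj f : increasing f -> injective f.
Proof.
move=> /increasingP mf i j e; apply/eqP; rewrite -val_eqE /=.
by case: ltngtP => // /mf; rewrite e ltnn.
Qed.

Definition precomp (s : 'S_n) (f : {ffun 'I_n -> 'I_p}) : {ffun 'I_n -> 'I_p} :=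
  [ffun i => f (s i)].

Lemma precompK s : cancel (precomp s^-1%g) (precomp s).
Proof. by move=> f; apply/ffunP => i; rewrite !ffunE permK. Qed.

(** The sorting permutation is the inverse of the rank of f i among the values
    of f. *)
Lemma sorting_perm (f : {ffun 'I_n -> 'I_p}) : injective f ->
  exists s0, forall s, increasing (precomp s f) = (s == s0).
Proof.
move=> fi.
have r_lt i : (#|[set j | (f j < f i)%N]| < n)%N.
  rewrite -[n in (_ < n)%N]card_ord -cardsT; apply: proper_card.
  by apply/properP; split; [by apply/fintype.subsetP => k; rewrite inE|exists i; rewrite !inE ?ltnn].
pose r i := Ordinal (r_lt i).
have r_mono i j : (f i < f j)%N -> (r i < r j)%N.
  move=> ij; apply: proper_card; apply/properP; split.
    by apply/fintype.subsetP => k; rewrite !inE => /ltn_trans; apply.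
  by exists i; rewrite inE ?ltnn.
have r_inj : injective r.
  move=> i j e; apply: fi; apply/eqP; rewrite -val_eqE.
  by case: ltngtP => // /r_mono; rewrite e ltnn.
exists (perm r_inj)^-1%g => s; apply/idP/eqP => [/increasingP inc|->].
  suff e : (s * perm r_inj)%g = 1%g by rewrite -[s](mulgK (perm r_inj)) e mul1g.
  apply/permP => i; rewrite permM perm1 permE; apply: val_inj => /=.
  have inc' j k : (f (s j) < f (s k))%N = (j < k)%N.
    have [jk|kj|/val_inj ->] := ltngtP j k; last by rewrite ltnn.
      by have := inc _ _ jk; rewrite !ffunE.
    by have := inc _ _ kj; rewrite !ffunE => h; apply/negbTE; rewrite -leqNgt ltnW.
  rewrite -(card_imset _ (@perm_inj _ s^-1)%g).
  have -> : (s^-1)%g @: [set j | (f j < f (s i))%N] = [set k : 'I_n | (k < i)%N].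
    apply/setP => k; rewrite inE -inc'; apply/imsetP/idP => [[j]|lt].
      by rewrite inE => lt ->; rewrite permKV.
    by exists (s k); rewrite ?inE ?permK.
  rewrite -sum1_card.
  rewrite (eq_bigl (fun k : 'I_n => (k < i)%N)); last by move=> k; rewrite inE.
  by rewrite -(big_ord_widen n (fun=> 1%N)) ?(ltnW (ltn_ord i)) // sum1_card card_ord.
apply/increasingP => i j ij; rewrite !ffunE.
set a := (_ i); set b := (_ j); have ra : r a = i by rewrite -[r a](permE r_inj) permKV.
have rb : r b = j by rewrite -[r b](permE r_inj) permKV.
rewrite ltnNge leq_eqVlt; apply/norP; split.
  apply/eqP => /val_inj/fi e; move: ij; rewrite -ra -rb e ltnn //.
by apply/negP => /r_mono; rewrite ra rb; apply/negP; rewrite -leqNgt ltnW.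
Qed.

(** The Cauchy-Binet formula.  Expanding by multilinearity gives a sum over
    all maps f; those that are not injective have two equal rows, and each of
    the others is an increasing map composed with a unique permutation. *)
Lemma det_mulmx_sum (A : 'M[K]_(n, p)) (B : 'M[K]_(p, n)) :
  \det (A *m B) = \sum_(f : {ffun 'I_n -> 'I_p} | increasing f)
    \det (colsub f A) * \det (rowsub f B).
Proof.
pose F (f : {ffun 'I_n -> 'I_p}) := (\prod_i A i (f i)) * \det (rowsub f B).
have F0 (f : {ffun 'I_n -> 'I_p}) : ~~ injectiveb f -> F f = 0.
  move=> /injectivePn[i [j ij e]]; rewrite /F (@determinant_alternate _ _ _ i j) ?mulr0 //.
  by move=> k; rewrite !mxE e.
have -> : \det (A *m B) = \sum_(f : {ffun 'I_n -> 'I_p}) F f.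
  rewrite /determinant.
  under eq_bigr => s _.
    under eq_bigr => i _ do rewrite mxE.
    rewrite bigA_distr_bigA mulr_sumr; over.
  rewrite exchange_big; apply: eq_bigr => f _.
  rewrite /F /determinant mulr_sumr; apply: eq_bigr => s _.
  by rewrite big_split /= mulrCA; do 2 congr (_ * _); apply: eq_bigr => i _; rewrite mxE.
rewrite (bigID (fun f : {ffun 'I_n -> 'I_p} => injectiveb f)) /= [X in _ + X]big1 // addr0.
transitivity (\sum_(f : {ffun 'I_n -> 'I_p} | injectiveb f)
    \sum_(s : 'S_n | increasing (precomp s f)) F f).
  apply: eq_bigr => f /injectiveP /sorting_perm[s0 e].
  by rewrite (eq_bigl _ _ e) big_pred1_eq.
rewrite (exchange_big_dep xpredT) //=.
transitivity (\sum_(s : 'S_n)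
   \sum_(g : {ffun 'I_n -> 'I_p} | increasing g) F (precomp s^-1%g g)).
  apply: eq_bigr => s _.
  (* For a fixed s the injective maps that s sorts are the g o s^-1, g increasing. *)
  rewrite (reindex_inj (can_inj (precompK s))) /=; apply: eq_bigl => g.
  rewrite precompK andb_idl // => /increasing_inj gi; apply/injectiveP => i j.
  by rewrite !ffunE => /gi /perm_inj.
rewrite exchange_big; apply: eq_bigr => g _ /=.
rewrite [X in _ = X * _]/determinant mulr_suml.
rewrite (reindex_inj (@invg_inj 'S_n)); apply: eq_bigr => s _; rewrite invgK /F.
have -> : rowsub (precomp s g) B = row_perm s (rowsub g B).
  by apply/matrixP => i j; rewrite !mxE ffunE.
rewrite row_permE det_mulmx det_perm mulrA [_ * (-1) ^+ _]mulrC.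
by congr (_ * _ * _); apply: eq_bigr => i _; rewrite mxE ffunE.
Qed.

End CauchyBinet.

Section BoxPartitions.
Implicit Types (mu nu : intpart).

Lemma nth_filter_part (s : seq nat) i : sorted geq s ->
  nth 0 [seq x <- s | x != 0%N] i = nth 0 s i.
Proof.
elim: s i => [|x s IH] i //= xs.
have ss : sorted geq s by exact: path_sorted xs.
case: eqP => [x0|_] /=; last by case: i => //= i; exact: IH.
have s0 : all (pred1 0%N) s.
  have := order_path_min geq_transitive xs; rewrite x0; apply: sub_all => y /=.
  by rewrite leqn0.
rewrite IH // (all_pred1P _ _ s0) x0.
by case: i => [|i] //=; rewrite !nth_nseq !if_same.
Qed.

Lemma part_of_seq_proof (s : seq nat) : sorted geq s ->
  is_part [seq x <- s | x != 0%N].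
Proof.
by move=> ss; rewrite /is_part mem_filter eqxx andbT (sorted_filter geq_transitive).
Qed.

Lemma nth_part_inj mu nu : (forall i, nth 0 mu i = nth 0 nu i)%N -> mu = nu.
Proof.
move=> e; apply: val_inj => /=.
have le m n : (forall i, nth 0 (parts m) i = nth 0 (parts n) i)%N -> (size n <= size m)%N.
  move=> e'; rewrite leqNgt; apply/negP => lt.
  have /andP[_ /negP] := partsP n; apply; rewrite -[0%N](nth_default 0%N (leqnn (size m))).
  by rewrite e' mem_nth.
by apply: (@eq_from_nth _ 0%N) => [|i _]; rewrite ?e //; apply/eqP; rewrite eqn_leq !le.
Qed.

Lemma bead_eq_inj N mu nu : (size mu <= N)%N -> (size nu <= N)%N ->
  (forall i : 'I_N, bead mu i = bead nu i) -> mu = nu.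
Proof.
move=> smu snu e; apply: nth_part_inj => i; case: (ltnP i N) => iN.
  by have := e (Ordinal iN); rewrite /bead /=; lia.
by rewrite !nth_default // (leq_trans _ iN).
Qed.

Lemma nth_window N j : (j < N + N)%N -> nth 0 (window N) j = N%:Z - 1 - j%:Z.
Proof.
have nth_desc lo n i : (i < n)%N -> nth 0 (desc lo n) i = lo + n%:Z - 1 - i%:Z.
  elim: n i => // n IH [|i] /= lt; first lia.
  by rewrite IH //; lia.
by move=> jN; rewrite nth_desc //; lia.
Qed.

Variable N : nat.
Implicit Types f : {ffun 'I_N -> 'I_(N + N)}.

Lemma increasing_gap f (i j : 'I_N) : increasing f -> (i <= j)%N ->
  (f i + (j - i) <= f j)%N.
Proof.
move=> /increasingP mf ij; have : j = (i + (j - i))%N :> nat by lia.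
move: (j - i)%N => d; elim: d j {ij} => [|d IH] j e.
  by rewrite addn0; have -> : i = j by apply: val_inj; rewrite /= e addn0.
have lt : (i + d < N)%N by have := ltn_ord j; lia.
have := IH (Ordinal lt) erefl; have := mf (Ordinal lt) j.
rewrite /= e addnS ltnS leqnn => /(_ isT) h1 h2; rewrite addnS.
exact: leq_ltn_trans h2 h1.
Qed.

Lemma increasing_le f (i : 'I_N) : increasing f -> (f i <= N + i)%N.
Proof.
move=> mf; have N0 : (N.-1 < N)%N by have := ltn_ord i; lia.
have iN : (i <= Ordinal N0)%N by have := ltn_ord i; rewrite /=; lia.
have := increasing_gap mf iN; have := ltn_ord (f (Ordinal N0)); have := ltn_ord i.
by case: (f (Ordinal N0)) => b ?; case: (f i) => a ? /=; lia.
Qed.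

(** The i-th part of the partition whose beads are the elements of the window
    at the positions listed by f; positions count from the top of the window,
    hence the bead is N - 1 - f i. *)
Definition box_value f (i : nat) : nat :=
  if insub i is Some i' then (N + i - f i')%N else 0.

Lemma box_sorted f : increasing f -> sorted geq (mkseq (box_value f) N).
Proof.
move=> mf; rewrite /mkseq.
have e : {in iota 0 N &, forall i j, (i < j)%N -> geq (box_value f i) (box_value f j)}.
  move=> i j; rewrite !mem_iota /= => iN jN ij; rewrite /box_value.
  rewrite (insubT (fun k => k < N)%N iN) (insubT (fun k => k < N)%N jN) /=.
  have := @increasing_gap f (Ordinal iN) (Ordinal jN) mf (ltnW ij).
  by case: (f (Ordinal iN)) => a ?; case: (f (Ordinal jN)) => b ? /=; lia.
by rewrite (homo_sorted_in e _ (iota_ltn_sorted 0 N)) //; apply/allP.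
Qed.

Definition box_part f : intpart :=
  insubd empty_part [seq x <- mkseq (box_value f) N | x != 0%N].

Lemma bead_box f (i : 'I_N) : increasing f ->
  bead (box_part f) i = N%:Z - 1 - (f i)%:Z.
Proof.
move=> mf; rewrite /bead /box_part insubdK ?nth_filter_part ?box_sorted //; last first.
  exact: (part_of_seq_proof (box_sorted mf)).
rewrite nth_mkseq // /box_value valK.
by have := increasing_le i mf; lia.
Qed.

Lemma size_box f : increasing f -> (size (box_part f) <= N)%N.
Proof.
move=> mf; rewrite /box_part insubdK; last exact: (part_of_seq_proof (box_sorted mf)).
by rewrite size_filter (leq_trans (count_size _ _)) // size_mkseq.
Qed.

Lemma box_part_inj f g : increasing f -> increasing g ->
  box_part f = box_part g -> f = g.
Proof.
move=> mf mg e; apply/ffunP => i; apply: val_inj => /=.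
by have := bead_box i mf; rewrite e bead_box //; lia.
Qed.

(** Increasing maps into the window are the bead sets of the partitions that
    fit in a square of side N. *)
Lemma box_part_surj mu : (size mu <= N)%N -> (head 0 mu <= N)%N ->
  exists2 f, increasing f & box_part f = mu.
Proof.
move=> sN hN.
have lt (i : 'I_N) : (absz (N%:Z - 1 - bead mu i)%R < N + N)%N.
  have := nth_part_le mu (leq0n i); have := ltn_ord i.
  by rewrite /bead nth0; lia.
have mf : increasing [ffun i => Ordinal (lt i)].
  apply/increasingP => i j ij; rewrite !ffunE /=.
  have := bead_decr mu ij; have := nth_part_le mu (leq0n i).
  by rewrite /bead nth0; lia.
exists [ffun i => Ordinal (lt i)] => //.
apply: (bead_eq_inj (size_box mf) sN) => i; rewrite bead_box // ffunE /=.
have := nth_part_le mu (leq0n i).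
by rewrite /bead nth0; lia.
Qed.

End BoxPartitions.

(** Both Jacobi-Trudi determinants are minors, on the columns given by the
    beads of eta, of matrices with entries h_(bead - l); partitions eta that
    do not fit in the square contribute zero. *)
Lemma sum_skew (K : fieldType) (phi h : nat -> K) N (mu nu : intpart) :
  (forall n, n.+1%:R != 0 :> K) -> h 0 = 1 ->
  (forall n, n.+1%:R * h n.+1 = \sum_(k < n.+1) phi k.+1 * h (n - k)%N) ->
  (size mu <= N)%N -> (head 0 mu <= N)%N -> (size nu <= N)%N ->
  \sum_(eta \in [set: intpart]%classic)
    specialize phi (skew_schur K mu eta) * specialize phi (skew_schur K nu eta)
  = \det (\matrix_(i < N, j < N)
      \sum_(l <- window N) zext h (bead mu i - l) * zext h (bead nu j - l)).
Proof.
move=> char0 h0 newton smu hmu snu.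
rewrite (fsbigTE [fset box_part f | f : {ffun 'I_N -> 'I_(N + N)} in
   [pred f | increasing f]]%fset); last first.
  move=> eta /imfsetP notin.
  case: (ltnP N (size eta)) => sN.
    by rewrite (specialize_skew_long char0 h0 newton) ?mul0r // (leq_ltn_trans smu).
  case: (ltnP N (head 0 eta)) => hN.
    by rewrite (specialize_skew_wide char0 h0 newton) ?mul0r // (leq_ltn_trans hmu).
  have [f mf e] := box_part_surj sN hN.
  by case: notin; exists f.
rewrite big_imfset /=; last by move=> f g mf mg; exact: box_part_inj.
rewrite big_enum_cond /=.
pose M la : 'M[K]_(N, N + N) :=
  \matrix_(i, j) zext h (bead la i - nth 0 (window N) j).
transitivity (\det (M mu *m (M nu)^T)).
  rewrite det_mulmx_sum; apply: eq_big => [f|f]; rewrite andbT // => mf.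
  rewrite !(specialize_skew char0 h0 newton (N := N)) ?size_box // /jt; congr (_ * _).
    by congr (\det _); apply/matrixP => i j; rewrite !mxE bead_box // nth_window.
  by rewrite -det_tr; congr (\det _); apply/matrixP => i j;
    rewrite !mxE bead_box // nth_window.
congr (\det _); apply/matrixP => i j; rewrite !mxE (big_nth 0) big_mkord size_window.
by apply: eq_bigr => k _; rewrite !mxE.
Qed.

(** * Linear relations between the rows *)

Section InverseSequences.
Variable K : fieldType.
Implicit Types (u v h e : nat -> K).

Lemma sum_window N (F : int -> K) :
  \sum_(k <- window N) F k = \sum_(p < N) F (Negz p) + \sum_(p < N) F (Posz p).
Proof.
have e : perm_eq (window N) (map Negz (iota 0 N) ++ map Posz (iota 0 N)).
  apply: uniq_perm; first exact: desc_uniq.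
    rewrite cat_uniq !map_inj_uniq ?iota_uniq ?andbT /=; try by move=> ? ? [].
    by apply/hasPn => _ /mapP[p _ ->]; apply/mapP => -[].
  move=> k; rewrite mem_cat mem_window; apply/idP/orP => [|[]].
  - case: k => p kN; [right|left]; apply/mapP; exists p => //; rewrite mem_iota; lia.
  - by case/mapP=> p; rewrite mem_iota => pN ->; lia.
  - by case/mapP=> p; rewrite mem_iota => pN ->; lia.
rewrite (perm_big _ e) big_cat !big_map /=.
rewrite -(big_mkord xpredT (fun p => F (Negz p))) -(big_mkord xpredT (fun p => F (Posz p))).
by rewrite /index_iota subn0.
Qed.

Lemma sum_zext N (F : nat -> K) u (m : nat) : (m < N)%N ->
  \sum_(n < N) zext u (m%:Z - n%:Z) * F n = \sum_(n < m.+1) u (m - n)%N * F n.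
Proof.
move=> mN; rewrite [RHS](big_ord_widen N (fun n => u (m - n)%N * F n)) //.
rewrite [RHS]big_mkcond; apply: eq_bigr => n _; rewrite ltnS.
case: leqP => nm; last by rewrite zext_neg ?mul0r //; lia.
by rewrite subzn.
Qed.

(** Lower triangular Toeplitz matrices multiply as their generating sequences
    convolve. *)
Lemma conv_zext N u v : (forall n, \sum_(k < n.+1) u (n - k)%N * v k = (n == 0)%:R) ->
  forall i j, (i < N)%N -> (j < N)%N ->
  \sum_(n < N) zext u (i%:Z - n%:Z) * zext v (n%:Z - j%:Z) = (i == j)%:R.
Proof.
move=> uv i j iN jN; rewrite (sum_zext (fun n => zext v (n%:Z - j%:Z))) //.
case: (ltnP i j) => [ij|ji].
  rewrite ltn_eqF // big1 // => n _; rewrite zext_neg ?mulr0 //.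
  by have := ltn_ord n; lia.
rewrite -(big_mkord xpredT (fun n => u (i - n)%N * zext v (n%:Z - j%:Z))).
rewrite (big_cat_nat _ (n := j)) //=; last by lia.
rewrite big_nat big1 ?add0r => [|n nj]; last by rewrite zext_neg ?mulr0 //; lia.
rewrite -{1}[j]add0n big_addn subSn // big_mkord.
rewrite eqn_leq ji andbT -subn_eq0 -uv; apply: eq_bigr => n _.
rewrite -subnDA [(j + n)%N]addnC; congr (_ * _).
by have -> : (n + j)%:Z - j%:Z = n by lia.
Qed.

(** With u_n = (-1)^n e_n and v_n = h_n this is, up to a sign, the Schur
    function of the hook with arm m and leg n. *)
Definition hook u v m n : K := \sum_(p < n.+1) u (n - p)%N * v (m.+1 + p)%N.

Definition overlap u m n : K :=
  \sum_(s < (minn m n).+1) u (m - s)%N * u (n - s)%N.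

Lemma overlap_zext N u m n : (m < N)%N ->
  overlap u m n = \sum_(s < N) zext u (m%:Z - s%:Z) * zext u (n%:Z - s%:Z).
Proof.
move=> mN; rewrite /overlap.
rewrite (big_ord_widen N (fun s => u (m - s)%N * u (n - s)%N)); last by lia.
rewrite big_mkcond; apply: eq_bigr => s _; rewrite ltnS leq_min.
case: (leqP s m) => sm /=; last by rewrite zext_neg ?mul0r //; lia.
case: (leqP s n) => sn /=; last by rewrite [X in _ * X]zext_neg ?mulr0 //; lia.
by rewrite !subzn.
Qed.

Variables (N : nat) (h e : nat -> K).
Hypothesis eh : forall n, \sum_(k < n.+1) e (n - k)%N * h k = (n == 0)%:R.

Lemma inverse_seqC n : \sum_(k < n.+1) h (n - k)%N * e k = (n == 0)%:R.
Proof.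
rewrite -eh (reindex_inj rev_ord_inj); apply: eq_bigr => k _.
by rewrite /= subSS mulrC subKn // -ltnS.
Qed.

(** The product of the lower triangular Toeplitz matrix of h and of its
    transpose; cutting the sum at -N does not disturb the factorization. *)
Definition pairing (k c : int) : K :=
  \sum_(l <- window N) zext h (k - l) * zext h (c - l).

(** For a negative row index only negative l contribute. *)
Lemma pairing_hole (n : nat) c : pairing (Negz n) c
  = \sum_(p < N) zext h (p%:Z - n%:Z) * zext h (c + p.+1%:Z).
Proof.
rewrite /pairing sum_window [X in _ + X]big1 ?addr0 => [|p _].
  apply: eq_bigr => p _; congr (zext _ _ * zext _ _); lia.
by rewrite zext_neg ?mul0r //; lia.
Qed.

(** Subtracting from row m its projection along the rows of negative index
    cancels the terms with l < 0, because the hook sums are L_(m,.) times the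
    inverse of the negative block of L.  The terms with l >= 0 that survive
    form an overlap and vanish on negative columns. *)
Lemma pairing_particle (m : nat) c : (m < N)%N -> c < N%:Z ->
  pairing m c = \sum_(n < N) hook e h m n * pairing (Negz n) c
              + \sum_(n < N) overlap h m n * (c == Posz n)%:R.
Proof.
move=> mN cN; rewrite [LHS]/pairing sum_window; congr (_ + _).
  under [RHS]eq_bigr => n _.
    rewrite pairing_hole mulr_sumr.
    under eq_bigr => p _ do rewrite mulrA.
    over.
  rewrite exchange_big; apply: eq_bigr => p _ /=; rewrite -mulr_suml.
  congr (_ * _).
  transitivity (\sum_(n < N) \sum_(j < N)
      h (m.+1 + j)%N * (zext h (p%:Z - n%:Z) * zext e (n%:Z - j%:Z))).
    rewrite exchange_big /=.
    under eq_bigr => j _ do rewrite -mulr_sumr (conv_zext inverse_seqC) //.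
    rewrite (bigD1 p) //= eqxx mulr1 big1 ?addr0 => [|j jp].
      by rewrite addSnnS.
    by rewrite (negbTE (_ : p != j :> nat)) ?mulr0 // eq_sym.
  apply: eq_bigr => n _; rewrite /hook -(@sum_zext N (fun p => h (m.+1 + p)%N)) //.
  by rewrite mulr_suml; apply: eq_bigr => j _; ring.
case: c cN => c cN.
  have c_lt : (c < N)%N by lia.
  rewrite [RHS](bigD1 (Ordinal c_lt)) //= eqxx mulr1 (overlap_zext _ _ mN).
  rewrite [X in _ + X]big1 ?addr0 // => n nc; case: eqP => [[ce]|]; rewrite ?mulr0 //.
  by rewrite -val_eqE /= -ce eqxx in nc.
rewrite !big1 // => n _; first by rewrite mulr0.
by rewrite [X in _ * X]zext_neg ?mulr0 //; lia.
Qed.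

(** The overlap of e is the inverse of the negative block of the pairing,
    because the inverse of L U is the product of the two inverses.  On columns
    c >= 0 it leaves the transposed hook sums. *)
Lemma pairing_hole_inverse (m : nat) c : (m < N)%N -> - N%:Z <= c -> c < N%:Z ->
  \sum_(n < N) overlap e m n * pairing (Negz n) c
  = (c == Negz m)%:R + \sum_(n < N) hook e h n m * (c == Posz n)%:R.
Proof.
move=> mN c1 c2.
transitivity (\sum_(p < N) zext e (m%:Z - p%:Z) * zext h (c + p.+1%:Z)).
  under eq_bigr => n _.
    rewrite pairing_hole (overlap_zext _ _ mN) mulr_suml.
    under eq_bigr => s _ do rewrite mulr_sumr.
    over.
  rewrite exchange_big /=; apply: eq_bigr => s _.
  rewrite exchange_big /= (bigD1 s) //= [X in _ + X]big1 => [|p ps].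
    rewrite addr0 -[RHS]mulr1.
    have <- : (s == s :> nat)%:R = 1 :> K by rewrite eqxx.
    rewrite -(conv_zext inverse_seqC (ltn_ord s) (ltn_ord s)) mulr_sumr.
    by apply: eq_bigr => n _; ring.
  transitivity (zext e (m%:Z - s%:Z) * zext h (c + p.+1%:Z) * (p == s :> nat)%:R);
    last by rewrite (negbTE (_ : p != s :> nat)) ?mulr0.
  rewrite -(conv_zext inverse_seqC (ltn_ord p) (ltn_ord s)) mulr_sumr.
  by apply: eq_bigr => n _; ring.
case: c c1 c2 => c c1 c2.
  have c_lt : (c < N)%N by lia.
  rewrite add0r [RHS](bigD1 (Ordinal c_lt)) //= eqxx mulr1 [X in _ + X]big1 ?addr0.
    rewrite (sum_zext (fun p => zext h (c%:Z + p.+1%:Z))) // /hook.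
    by apply: eq_bigr => p _; rewrite addSnnS.
  move=> n nc; case: eqP => [[ce]|]; rewrite ?mulr0 //.
  by rewrite -val_eqE /= -ce eqxx in nc.
rewrite [X in _ + X]big1 ?addr0 => [|n _]; last by rewrite mulr0.
have cN : (c < N)%N by lia.
have -> : (Negz c == Negz m) = (m == c) by rewrite eq_sym.
rewrite -(conv_zext eh mN cN); apply: eq_bigr => p _; congr (_ * zext _ _); lia.
Qed.

End InverseSequences.

(** * The complete and elementary functions at q^(-rho) *)

Section QSequences.
Variables (K : fieldType) (t : K).
Hypothesis t0 : t != 0.
Hypothesis qnum_neq0 : forall n, qnum t n.+1 != 0.

Local Notation r := (t ^+ 6).

Lemma qpow12D k l : qpow12 t (k + l) = qpow12 t k * qpow12 t l.
Proof. exact: expfzDr. Qed.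

Lemma qpow12N k : qpow12 t (- k) = (qpow12 t k)^-1.
Proof. by rewrite /qpow12 -invr_expz. Qed.

Lemma qpow12_neq0 k : qpow12 t k != 0.
Proof. exact: expfz_neq0. Qed.

Lemma qpow12_6n (n : nat) : qpow12 t (6%:Z * n%:Z) = r ^+ n.
Proof. by rewrite /qpow12 -PoszM -exprnP exprM. Qed.

Lemma qnumE n : qnum t n = r ^+ n - r ^- n.
Proof. by rewrite /qnum qpow12N qpow12_6n. Qed.

Lemma qfact0 : qfact t 0 = 1.
Proof. by rewrite /qfact big_geq. Qed.

Lemma qfactS n : qfact t n.+1 = qfact t n * qnum t n.+1.
Proof. by rewrite /qfact big_nat_recr. Qed.

Lemma qfact_neq0 n : qfact t n != 0.
Proof.
elim: n => [|n IH]; first by rewrite /qfact big_geq // oner_eq0.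
by rewrite qfactS mulf_neq0.
Qed.

(** The value of h_n at q^(-rho), namely 1 / ((1-q) ... (1-q^n)) times
    q^(n/2), written with symmetric q-numbers. *)
Definition complete_q (n : nat) : K :=
  (-1) ^+ n * qpow12 t (- (3%:Z * (n%:Z * (n%:Z - 1)))) / qfact t n.

(** The value of (-1)^n e_n at q^(-rho). *)
Definition elementary_q (n : nat) : K :=
  qpow12 t (3%:Z * (n%:Z * (n%:Z - 1))) / qfact t n.

Lemma complete_q0 : complete_q 0 = 1.
Proof. by rewrite /complete_q /qfact big_geq // !mul1r invr1. Qed.

Lemma complete_qS n : complete_q n.+1 = - complete_q n / r ^+ n / qnum t n.+1.
Proof.
rewrite /complete_q qfactS exprS.
have -> : - (3%:Z * (n.+1%:Z * (n.+1%:Z - 1)))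
    = - (3%:Z * (n%:Z * (n%:Z - 1))) + - (6%:Z * n%:Z) by lia.
rewrite qpow12D [qpow12 _ (- (6%:Z * _))]qpow12N qpow12_6n invfM.
by ring.
Qed.

Lemma r_neq0 : r != 0. Proof. by rewrite expf_neq0. Qed.

Lemma one_sub_neq0 n : 1 - r ^+ n.+1 * r ^+ n.+1 != 0.
Proof.
have R0 : r ^+ n.+1 != 0 by rewrite expf_neq0 // r_neq0.
apply: contraNneq (qnum_neq0 n) => e; rewrite qnumE; apply/eqP; apply: (mulfI R0).
by rewrite mulrBr divff // mulr0 -[RHS]oppr0 -e opprB.
Qed.

(** From H(z) = prod_i 1/(1 - q^(i-1/2) z), H(qz) = (1 - q^(1/2) z) H(z);
    compare the coefficients. *)
Lemma complete_q_rec n : complete_q n.+1 * (1 - r ^+ n.+1 * r ^+ n.+1) = r * complete_q n.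
Proof.
rewrite complete_qS.
have := qnum_neq0 n; rewrite qnumE exprS; have := r_neq0.
have : r ^+ n != 0 by rewrite expf_neq0 // r_neq0.
move: (r ^+ n) (complete_q n) => x c x0; move: r => R R0 h.
have h' : R * x * (R * x) - 1 != 0.
  apply: contraNneq h => e; apply/eqP; apply: (mulfI (mulf_neq0 R0 x0)).
  by rewrite mulrBr divff ?mulf_neq0 // mulr0.
by field; rewrite ?x0 ?R0 ?h' //=; apply/andP; split.
Qed.

(** The sum telescopes, since q^m h_m = h_m - q^(1/2) h_(m-1). *)
Lemma sum_geometric_complete n :
  \sum_(k < n.+1) r ^+ k.+1 * (r ^+ (n - k) * r ^+ (n - k) * complete_q (n - k)%N)
  = r * complete_q n.
Proof.
elim: n => [|n IH]; first by rewrite big_ord_recl big_ord0 /= !mul1r addr0 expr1.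
rewrite big_ord_recl /= subn0 expr1.
under eq_bigr => k _ do rewrite /bump /= add1n subSS exprS -mulrA.
rewrite -mulr_sumr IH -complete_q_rec; ring.
Qed.

(** Induction on n after multiplication by 1 - q^(n+2): split it as (1 -
    q^(n+1-k)) + q^(n+1-k) (1 - q^(k+1)).  The first part lowers the index of
    h and reproduces the identity for n, the second cancels the denominator of
    the power sum and leaves a geometric sum. *)
Lemma complete_q_newton n : (n.+1%:R : K) * complete_q n.+1
  = \sum_(k < n.+1) - (qnum t k.+1)^-1 * complete_q (n - k)%N.
Proof.
elim: n => [|n IH].
  rewrite big_ord_recl big_ord0 addr0 subnn /= mul1r complete_qS complete_q0 expr0.
  by rewrite invr1 mulr1 mulr1 mulN1r.
apply: (mulIf (one_sub_neq0 n.+1)); rewrite -mulrA complete_q_rec mulr_suml.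
have geo k : - (qnum t k.+1)^-1 * (1 - r ^+ k.+1 * r ^+ k.+1) = r ^+ k.+1.
  have := qnum_neq0 k; rewrite qnumE.
  have : r ^+ k.+1 != 0 by rewrite expf_neq0 // r_neq0.
  move: (r ^+ k.+1) => x x0 h.
  have h' : x * x - 1 != 0.
    apply: contraNneq h => e; apply/eqP; apply: (mulfI x0).
    by rewrite mulrBr divff // mulr0.
  by field; apply/andP; split.
transitivity (\sum_(k < n.+2)
   (- (qnum t k.+1)^-1 * (complete_q (n.+1 - k)%N * (1 - r ^+ (n.+1 - k) * r ^+ (n.+1 - k)))
    + r ^+ k.+1 * (r ^+ (n.+1 - k) * r ^+ (n.+1 - k) * complete_q (n.+1 - k)%N))); last first.
  apply: eq_bigr => k _; rewrite -[X in _ + X * _]geo.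
  have -> : r ^+ n.+2 = r ^+ k.+1 * r ^+ (n.+1 - k).
    by rewrite -exprD; congr (_ ^+ _); have := ltn_ord k; lia.
  by move: (r ^+ _) (r ^+ _) (_^-1) (complete_q _) => *; ring.
rewrite big_split /= sum_geometric_complete big_ord_recr /= subnn expr0.
rewrite mulr1 subrr !mulr0 addr0.
under eq_bigr => k _.
  rewrite subSn; last by rewrite -ltnS.
  rewrite complete_q_rec mulrCA; over.
rewrite -mulr_sumr -IH -[n.+2%:R]natr1; ring.
Qed.

(** Induction on n through the Pieri relation for e_(n+1) h_(m+1), which is
    the sum of two neighbouring hooks; it amounts to [m+1] q^((n+1)/2) =
    [m+n+2] - [n+1] q^(-(m+1)/2). *)
Lemma hook_q m n : hook elementary_q complete_q m n =
  (-1) ^+ m.+1 * qpow12 t (3%:Z * ((n * n.+1)%:Z - (m * m.+1)%:Z))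
  / (qnum t (m + n).+1 * qfact t m * qfact t n).
Proof.
elim: n m => [|n IH] m.
  rewrite /hook big_ord_recl big_ord0 addr0 /= subn0 addn0.
  rewrite {1}/elementary_q /complete_q qfactS /qfact big_geq // addn0 !mul1r invr1 mul1r.
  rewrite !mulr1 [qnum t _ * _]mulrC; congr (_ * qpow12 _ _ / _); lia.
have -> : hook elementary_q complete_q m n.+1
    = elementary_q n.+1 * complete_q m.+1 + hook elementary_q complete_q m.+1 n.
  rewrite /hook big_ord_recl /= subn0 addn0; congr (_ + _).
  by apply: eq_bigr => p _; rewrite /bump /= add1n subSS addnS addSn.
rewrite IH /elementary_q /complete_q addSn addnS !qfactS !exprS.
set U := qpow12 t (3%:Z * ((n * n.+1)%:Z - (m * m.+1)%:Z)).
have e1 : qpow12 t (3%:Z * (n.+1%:Z * (n.+1%:Z - 1)))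
   * qpow12 t (- (3%:Z * (m.+1%:Z * (m.+1%:Z - 1)))) = U.
  by rewrite -qpow12D /U; congr qpow12; lia.
have -> : qpow12 t (3%:Z * ((n.+1 * n.+2)%:Z - (m * m.+1)%:Z)) = U * r ^+ n.+1.
  by rewrite -qpow12_6n -qpow12D /U; congr qpow12; lia.
have -> : qpow12 t (3%:Z * ((n * n.+1)%:Z - (m.+1 * m.+2)%:Z)) = U / r ^+ m.+1.
  by rewrite -qpow12_6n -qpow12N -qpow12D /U; congr qpow12; lia.
have e2 : qnum t m.+1 * r ^+ n.+1 = qnum t (m + n).+2 - qnum t n.+1 / r ^+ m.+1.
  rewrite !qnumE; have -> : ((m + n).+2 = m.+1 + n.+1)%N by lia.
  rewrite exprD; have : r ^+ m.+1 != 0 by rewrite expf_neq0 // r_neq0.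
  have : r ^+ n.+1 != 0 by rewrite expf_neq0 // r_neq0.
  by move: (r ^+ m.+1) (r ^+ n.+1) => x y x0 y0; field; apply/andP; split.
have {}e2 : r ^+ n.+1 = (qnum t (m + n).+2 - qnum t n.+1 / r ^+ m.+1) / qnum t m.+1.
  by rewrite -e2 mulrAC divff // mul1r.
rewrite e2 -e1.
have := qnum_neq0 m; have := qnum_neq0 n; have := qnum_neq0 (m + n).+1.
have := qfact_neq0 m; have := qfact_neq0 n.
have : r ^+ m.+1 != 0 by rewrite expf_neq0 // r_neq0.
move: (r ^+ m.+1) (qfact t m) (qfact t n) (qnum t m.+1) (qnum t n.+1) (qnum t _).
move: (qpow12 t _) (qpow12 t _) ((-1) ^+ m) => T1 T2 s R fm fn x y z R0 fn0 fm0 z0 y0 x0.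
by field; rewrite R0 fn0 fm0 z0 y0 x0.
Qed.

(** The relation sum_k (-1)^(n-k) e_(n-k) h_k = 0 is the closed form of the
    hook with arm 0. *)
Lemma convolution_q n :
  \sum_(k < n.+1) elementary_q (n - k)%N * complete_q k = (n == 0)%:R.
Proof.
case: n => [|n].
  rewrite big_ord_recl big_ord0 addr0 /= complete_q0 mulr1 /elementary_q.
  by rewrite /qfact big_geq // divr1.
have -> : \sum_(k < n.+2) elementary_q (n.+1 - k)%N * complete_q k
    = elementary_q n.+1 + hook elementary_q complete_q 0 n.
  rewrite /hook big_ord_recl /= subn0 complete_q0 mulr1; congr (_ + _).
rewrite hook_q /elementary_q add0n qfactS qfact0 mulr1 mul0n subr0.
have -> : (n.+1%:Z * (n.+1%:Z - 1)) = (n * n.+1)%:Z by lia.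
by rewrite expr1 mulN1r mulNr [qfact t n * _]mulrC subrr.
Qed.

(** The exponents match since m(m+1) - (m-s)(m-s-1) = (s+1)(2m-s). *)
Lemma overlap_complete_q m n : overlap complete_q m n =
  (-1) ^+ (m + n) * qpow12 t (- (3%:Z * ((m * m.+1)%:Z + (n * n.+1)%:Z)))
  * \sum_(s < (minn m n).+1)
      qpow12 t (6%:Z * (s.+1 * (m + n - s))%:Z) / (qfact t (m - s) * qfact t (n - s)).
Proof.
rewrite /overlap mulr_sumr; apply: eq_bigr => s _.
have [sm sn] : (s <= m)%N /\ (s <= n)%N by have := ltn_ord s; lia.
rewrite /complete_q.
have -> : (-1) ^+ (m + n) = (-1) ^+ (m - s) * (-1) ^+ (n - s) :> K.
  rewrite -exprD -signr_odd -[RHS]signr_odd; congr (_ ^+ nat_of_bool _).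
  by rewrite !oddD !oddB //; case: (odd m); case: (odd n); case: (odd s).
have -> : qpow12 t (- (3%:Z * ((m - s)%:Z * ((m - s)%:Z - 1))))
   = qpow12 t (- (3%:Z * ((m * m.+1)%:Z + (n * n.+1)%:Z)))
     * qpow12 t (6%:Z * (s.+1 * (m + n - s))%:Z)
     * qpow12 t (3%:Z * ((n - s)%:Z * ((n - s)%:Z - 1))).
  rewrite -!qpow12D; congr qpow12; rewrite -!subzn ?(leq_trans sm (leq_addr _ _)) //; nia.
rewrite [qpow12 t (- (3%:Z * ((n - s)%:Z * _)))]qpow12N.
have := qpow12_neq0 (3%:Z * ((n - s)%:Z * ((n - s)%:Z - 1))).
have := qfact_neq0 (m - s); have := qfact_neq0 (n - s).
move: (qpow12 t _) (qpow12 t _) (qpow12 t _) (qfact t _) (qfact t _) (_ ^+ _) (_ ^+ _).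
by move=> a b c d e f g e0 d0 c0; field; rewrite ?e0 ?d0 ?c0.
Qed.

Lemma overlap_elementary_q m n : overlap elementary_q m n =
  qpow12 t (3%:Z * ((m * m.+1)%:Z + (n * n.+1)%:Z))
  * \sum_(s < (minn m n).+1)
      qpow12 t (- (6%:Z * (s.+1 * (m + n - s))%:Z)) / (qfact t (m - s) * qfact t (n - s)).
Proof.
rewrite /overlap mulr_sumr; apply: eq_bigr => s _.
have [sm sn] : (s <= m)%N /\ (s <= n)%N by have := ltn_ord s; lia.
rewrite /elementary_q mulrACA -invfM -qpow12D [RHS]mulrA -qpow12D.
by congr (qpow12 t _ / _); rewrite -!subzn ?(leq_trans sm (leq_addr _ _)) //; nia.
Qed.

End QSequences.

(** * Nonvanishing of Schur functions at q^(-rho) *)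

Section Nonvanishing.
Variables (K : fieldType) (t : K).
Hypothesis t0 : t != 0.
Hypothesis qnum_neq0 : forall n, qnum t n.+1 != 0.
Local Notation r := (t ^+ 6).

Lemma complete_q_neq0 n : complete_q t n != 0.
Proof.
by rewrite !mulf_neq0 ?invr_neq0 ?qfact_neq0 ?qpow12_neq0 // expf_neq0 // oppr_eq0 oner_eq0.
Qed.

(** The factors of h_(l-d) / h_l, as polynomials in q^l. *)
Definition ratio_poly (d : nat) : {poly K} :=
  \prod_(s < d) (r^-1 *: (1 - (r ^- s * r ^- s) *: 'X)).

Lemma ratio_polyS d : ratio_poly d.+1
  = ratio_poly d * (r^-1 *: (1 - (r ^- d * r ^- d) *: 'X)).
Proof. by rewrite /ratio_poly big_ord_recr. Qed.

Lemma ratio_poly_size d : size (ratio_poly d) = d.+1.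
Proof.
elim: d => [|d IH]; first by rewrite /ratio_poly big_ord0 size_poly1.
have r0 := r_neq0 t0.
have c0 : r ^- d * r ^- d != 0 by rewrite mulf_neq0 // invr_neq0 // expf_neq0.
have s2 : size (r^-1 *: (1 - (r ^- d * r ^- d) *: 'X)) = 2%N.
  rewrite size_scale ?invr_neq0 // addrC size_polyDl size_polyN size_scale // size_polyX //.
  by rewrite size_poly1.
rewrite ratio_polyS size_mul ?IH ?s2 ?addn2 //.
  by rewrite -size_poly_eq0 IH.
by rewrite -size_poly_eq0 s2.
Qed.

(** Iterating h_(l-1) = q^(-1/2) (1 - q^l) h_l; the factor 1 - q^0 takes care
    of the indices that would be negative. *)
Lemma complete_q_shift l d : zext (complete_q t) (l%:Z - d%:Z)
  = complete_q t l * (ratio_poly d).[r ^+ l * r ^+ l].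
Proof.
elim: d => [|d IH]; first by rewrite subr0 /ratio_poly big_ord0 hornerC mulr1.
rewrite ratio_polyS hornerM mulrA -IH.
have r0 := r_neq0 t0; have rd0 n : r ^+ n != 0 by rewrite expf_neq0.
rewrite hornerZ hornerD hornerN hornerZ hornerC hornerX mulrACA.
have [dl|ld] := ltnP d l.
  have [k ->] : exists k, l = (k.+1 + d)%N by exists (l - d.+1)%N; lia.
  have -> : (k.+1 + d)%:Z - d%:Z = k.+1 by lia.
  have -> : (k.+1 + d)%:Z - d.+1%:Z = k by lia.
  have -> : r ^- d * r ^+ (k.+1 + d) = r ^+ k.+1.
    by rewrite exprD mulrCA mulVf ?mulr1.
  by rewrite mulrCA complete_q_rec // mulrA mulVf // mul1r.
rewrite [LHS]zext_neg; last by lia.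
have [e|ne] := eqVneq d l; last by rewrite zext_neg ?mul0r //; lia.
by rewrite e mulVf // !(mulr1, subrr, mulr0).
Qed.

(** Polynomials of degrees 0, 1, ..., n - 1 are a triangular change of basis
    away from a Vandermonde matrix. *)
Lemma ratio_poly_det_neq0 n (x : 'I_n -> K) : injective x ->
  \det (\matrix_(d < n, i < n) (ratio_poly d).[x i]) != 0.
Proof.
move=> xi.
have -> : \matrix_(d < n, i < n) (ratio_poly d).[x i]
    = (\matrix_(d < n, k < n) (ratio_poly d)`_k) *m Vandermonde n (\row_i x i).
  apply/matrixP => d i; rewrite !mxE (@horner_coef_wide _ n); last first.
    by rewrite ratio_poly_size.
  by apply: eq_bigr => k _; rewrite !mxE.
rewrite det_mulmx mulf_neq0 //.
  rewrite det_trig; last first.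
    apply/is_trig_mxP => i j ij; rewrite mxE nth_default // ratio_poly_size.
    exact: ij.
  apply/prodf_neq0 => i _; rewrite mxE.
  have -> : (ratio_poly i)`_i = lead_coef (ratio_poly i).
    by rewrite lead_coefE ratio_poly_size.
  by rewrite lead_coef_eq0 -size_poly_eq0 ratio_poly_size.
rewrite det_Vandermonde; apply/prodf_neq0 => i _; apply/prodf_neq0 => j ij.
by rewrite !mxE subr_eq0; apply/eqP => /xi e; rewrite e ltnn in ij.
Qed.

(** Row i is h_(l_i) times the values at q^(l_i) of polynomials of all degrees
    below N, and the l_i = mu_i + N - i are distinct. *)
Lemma jt_complete_q_neq0 N (mu : intpart) : (size mu <= N)%N ->
  jt (complete_q t) N mu empty_part != 0.
Proof.
move=> sN.
have lE i : (i < N)%N -> bead mu i + N%:Z = absz (bead mu i + N%:Z).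
  by move=> iN; rewrite gez0_abs // /bead; lia.
pose l (i : 'I_N) : nat := absz (bead mu i + N%:Z).
have li : injective l.
  move=> i j; rewrite /l => e; apply: val_inj; apply: (@bead_inj mu).
  by apply: (addIr N%:Z); rewrite (lE i) // (lE j) // e.
pose x i := r ^+ l i * r ^+ l i.
have xi : injective x.
  have lt a b : (a < b)%N -> r ^+ a * r ^+ a != r ^+ b * r ^+ b.
    move=> ab; have -> : b = (a + (b - a.+1).+1)%N by lia.
    rewrite exprD mulrACA -[X in X != _]mulr1 (inj_eq (mulfI _)); last first.
      by rewrite mulf_neq0 // expf_neq0 // r_neq0.
    by rewrite -subr_eq0 one_sub_neq0.
  move=> i j /eqP e; apply: li; apply/eqP.
  case: ltngtP => // /lt; first by rewrite e.
  by rewrite eq_sym e.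
(* Column j carries the polynomial of degree N - 1 - j. *)
pose s := perm (@rev_ord_inj N).
rewrite /jt.
have -> : \matrix_(i, j) zext (complete_q t) (bead mu i - bead empty_part j)
   = diag_mx (\row_i complete_q t (l i))
     *m (col_perm s (\matrix_(d < N, i < N) (ratio_poly d).[x i])^T).
  apply/matrixP => i j; rewrite !mxE (bigD1 i) //= big1 ?addr0 => [|k ki].
    rewrite !mxE eqxx mulr1n permE -complete_q_shift; congr zext.
    rewrite /l -lE // /bead nth_nil /=; have := ltn_ord j; lia.
  by rewrite !mxE eq_sym (negbTE ki) mulr0n mul0r.
rewrite det_mulmx det_diag col_permE det_mulmx det_tr det_perm !mulf_neq0 //.
- by apply/prodf_neq0 => i _; rewrite mxE complete_q_neq0.
- exact: ratio_poly_det_neq0.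
- by rewrite expf_neq0 // oppr_eq0 oner_eq0.
Qed.

End Nonvanishing.

(** * Linear independence of Schur functions *)

Section PowerSumsFromComplete.
Variables (K : fieldType) (h : nat -> K).

Fixpoint newton_seq (n : nat) : seq K :=
  if n is m.+1 then
    let s := newton_seq m in
    rcons s (m.+1%:R * h m.+1 - \sum_(k < m) s`_k * h (m - k)%N)
  else [::].

Lemma size_newton_seq n : size (newton_seq n) = n.
Proof. by elim: n => //= n IH; rewrite size_rcons IH. Qed.

Lemma nth_newton_seq n k : (k < n)%N -> (newton_seq n)`_k = (newton_seq k.+1)`_k.
Proof.
elim: n => // n IH; rewrite ltnS leq_eqVlt => /orP[/eqP->//|kn].
by rewrite [LHS]/= nth_rcons size_newton_seq kn IH.
Qed.

(** The ring of symmetric functions is also free on the h_n, so any values may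
    be prescribed for them; Newton's identities are solved for the power sums
    one at a time. *)
Lemma exists_power_sums : h 0 = 1 -> exists phi : nat -> K,
  forall n, n.+1%:R * h n.+1 = \sum_(k < n.+1) phi k.+1 * h (n - k)%N.
Proof.
move=> h0; exists (fun k => (newton_seq k)`_k.-1) => n.
rewrite big_ord_recr /= subnn h0 mulr1 nth_rcons size_newton_seq ltnn eqxx.
rewrite addrC -addrA [X in _ + X](_ : _ = 0) ?addr0 // addrC; apply/eqP.
rewrite subr_eq0; apply/eqP; apply: eq_bigr => k _.
by rewrite (nth_newton_seq (ltn_ord k)).
Qed.

End PowerSumsFromComplete.

Definition alternant (R : comNzRingType) N (x : 'I_N -> R) (l : nat -> nat) : R :=
  \det (\matrix_(i < N, j < N) x j ^+ l i).

Definition staircase N (mu : intpart) (i : nat) : nat := (nth 0 mu i + N - i.+1)%N.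

Section Bialternant.
Variables (K : fieldType) (N : nat) (x : 'I_N -> K).
Hypothesis x_inj : injective x.

(** Instead of the complete functions of the variables x, take h_n = sum_j w_j
    x_j^(n+N-1) with weights chosen so that h_0 = 1 and h_n = 0 for -N < n <
    0, which is a Vandermonde system.  The Jacobi-Trudi matrix then factors as
    (x_j^(l_i)) diag(w) times a transposed Vandermonde matrix, and c is the
    determinant of the last two factors. *)
Lemma exists_bialternant : exists (h : nat -> K) (c : K),
  [/\ h 0 = 1, c != 0 & forall mu : intpart, (size mu <= N)%N ->
      jt h N mu empty_part = alternant x (staircase N mu) * c].
Proof.
case: N x x_inj => [|n] y y_inj.
  exists (fun n => (n == 0)%:R), 1; split; rewrite ?oner_eq0 // => mu _.
  by rewrite /jt /alternant !det_mx00 mulr1.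
pose V := Vandermonde n.+1 (\row_i y i).
have Vu : V \in unitmx.
  rewrite unitmxE unitfE det_Vandermonde; apply/prodf_neq0 => i _.
  apply/prodf_neq0 => j ij; rewrite !mxE subr_eq0; apply/eqP => /y_inj e.
  by rewrite e ltnn in ij.
have [w Vw] : exists w : 'I_n.+1 -> K,
    forall m, (m < n.+1)%N -> \sum_j w j * y j ^+ m = (m == n)%:R.
  pose w : 'cV[K]_n.+1 := invmx V *m delta_mx ord_max 0.
  exists (fun j => w j 0) => m mn.
  have := mulKVmx Vu (delta_mx ord_max 0 : 'cV[K]_n.+1).
  move/matrixP => /(_ (Ordinal mn) 0); rewrite -/w [RHS]mxE -val_eqE /= andbT => <-.
  by rewrite [RHS]mxE; apply: eq_bigr => j _; rewrite !mxE mulrC.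
(* The index is shifted by n = N - 1, the largest shift in the determinant. *)
pose h m := \sum_j w j * y j ^+ (m + n).
have h0 : h 0 = 1 by rewrite /h Vw // eqxx.
have hz (m : nat) : zext h (m%:Z - n%:Z) = \sum_j w j * y j ^+ m.
  have [nm|mn] := leqP n m; first by rewrite subzn //= /h subnK.
  by rewrite zext_neg ?Vw ?(ltn_eqF mn) ?(ltnW mn) //; lia.
pose c := (\prod_j w j) * \det V.
have jtE (mu : intpart) : (size mu <= n.+1)%N ->
    jt h n.+1 mu empty_part = alternant y (staircase n.+1 mu) * c.
  move=> _; rewrite /jt /c /alternant -[\det V]det_tr.
  have -> : \prod_j w j = \det (diag_mx (\row_j w j)).
    by rewrite det_diag; apply: eq_bigr => j _; rewrite mxE.
  rewrite -!det_mulmx; congr (\det _); apply/matrixP => i k; rewrite !mxE.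
  have -> : bead mu i - bead empty_part k = (staircase n.+1 mu i + k)%N%:Z - n%:Z.
    by rewrite /bead /staircase nth_nil; have := ltn_ord i; lia.
  rewrite hz; apply: eq_bigr => j _.
  by rewrite mul_diag_mx !mxE exprD; ring.
exists h, c; split => //.
(* c is not zero because the Jacobi-Trudi determinant of the empty partition is 1. *)
apply/eqP => c0; have := jtE empty_part isT; rewrite c0 mulr0 => /eqP.
by rewrite -(jt_stable (mu := empty_part) (nu := empty_part) h0) // /jt det_mx00 oner_eq0.
Qed.

End Bialternant.

(** Transcendence over the rational numbers; integral coefficients suffice
    after clearing denominators. *)
Definition transcendental (K : fieldType) (t : K) : Prop :=
  forall p : {poly int}, (map_poly intr p).[t] = 0 -> p = 0.

(** Uniqueness of the expansion in base M. *)
Lemma digits_inj M N (a b : 'I_N -> nat) :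
  (forall i, a i < M)%N -> (forall i, b i < M)%N ->
  (\sum_(i < N) a i * M ^ i = \sum_(i < N) b i * M ^ i)%N -> a =1 b.
Proof.
elim: N a b => [|N IH] a b aM bM; first by move=> _ [].
rewrite !big_ord_recl !expn0 !muln1.
have shift (c : 'I_N.+1 -> nat) : (\sum_(i < N) c (lift ord0 i) * M ^ lift ord0 i
    = (\sum_(i < N) c (lift ord0 i) * M ^ i) * M)%N.
  by rewrite big_distrl; apply: eq_bigr => i _; rewrite /= /bump /= add1n expnSr mulnA.
rewrite !shift => e.
have M0 : (0 < M)%N by exact: leq_ltn_trans (aM ord0).
have e0 : a ord0 = b ord0.
  have := congr1 (modn^~ M) e.
  by rewrite /= ![(_ ord0 + _)%N]addnC !modnMDl !modn_small ?aM ?bM.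
move/eqP: e; rewrite e0 eqn_add2l eqn_pmul2r // => /eqP e i.
case: (unliftP ord0 i) => [j ->|-> //].
by apply: (IH (fun i => a (lift ord0 i)) (fun i => b (lift ord0 i))).
Qed.

Lemma increasing_perm n (s : 'S_n) :
  (forall i j : 'I_n, (i < j)%N -> (s i < s j)%N) -> s = 1%g.
Proof.
move=> inc; pose f : {ffun 'I_n -> 'I_n} := [ffun i => i].
have fi : injective f by move=> i j; rewrite !ffunE.
have [s0 e] := sorting_perm fi.
have /eqP -> : s == s0 by rewrite -e; apply/increasingP => i j /inc; rewrite !ffunE.
apply/esym/eqP; rewrite -e.
by apply/increasingP => i j; rewrite !ffunE !perm1.
Qed.

(** With x_j = X^(M^j) the exponents of the terms of the alternant are written
    in base M with digits a permutation of the l_i.  As the l_i are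
    decreasing, the exponent of the diagonal term of la occurs in no other
    term and in no other alternant. *)
Lemma coef_alternant N M (la mu : intpart) : (size mu <= N)%N -> (size la <= N)%N ->
  (head 0 mu + N < M)%N -> (head 0 la + N < M)%N ->
  (alternant (fun j : 'I_N => 'X^(M ^ j) : {poly int}) (staircase N mu))
    `_(\sum_(i < N) staircase N la i * M ^ i) = (mu == la)%:R.
Proof.
move=> smu sla hmu hla; rewrite /alternant /determinant coef_sum.
have lt_M (nu : intpart) i : (head 0 nu + N < M)%N -> (staircase N nu i < M)%N.
  by have := nth_part_le nu (leq0n i); rewrite /staircase nth0; lia.
have sgn_coef (b : bool) (p : {poly int}) k : ((-1) ^+ b * p)`_k = (-1) ^+ b * p`_k.
  by case: b; rewrite ?expr1 ?expr0 ?mulN1r ?mul1r ?coefN.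
have term (s : 'S_N) :
    (\prod_i (\matrix_(i0 < N, j < N) (('X^(M ^ j) : {poly int}) ^+ staircase N mu i0)) i (s i))
    `_(\sum_(i < N) staircase N la i * M ^ i)
    = ((s == 1%g) && (mu == la))%:R.
  have -> : \prod_i (\matrix_(i0 < N, j < N) (('X^(M ^ j) : {poly int}) ^+ staircase N mu i0)) i (s i)
     = 'X^(\sum_(i < N) staircase N mu (s^-1%g i) * M ^ i).
    rewrite expr_sum [RHS](reindex_inj (@perm_inj _ s)) /=.
    by apply: eq_bigr => i _; rewrite mxE permK -exprM mulnC.
  rewrite coefXn; congr (_%:R); congr nat_of_bool; apply/eqP/andP => [e|[/eqP-> /eqP->]];
    last by apply: eq_bigr => i _; rewrite invg1 perm1.
  have {}e : (fun i : 'I_N => staircase N la i) =1 (fun i : 'I_N => staircase N mu (s^-1%g i)).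
    by apply: (digits_inj (M := M)) e => i; exact: lt_M.
  have decr nu (i j : 'I_N) : (staircase N nu j < staircase N nu i)%N = (i < j)%N.
    have lt (i' j' : 'I_N) : (i' < j')%N -> (staircase N nu j' < staircase N nu i')%N.
      move=> ij; have := nth_part_le nu (ltnW ij); have := ltn_ord j'.
      by rewrite /staircase; lia.
    have [ij|ji|/val_inj ->] := ltngtP i j; [exact: lt| |exact: ltnn].
    by apply/negbTE; rewrite -leqNgt ltnW // lt.
  have s1 : (s^-1 = 1)%g.
    by apply: increasing_perm => i j ij; rewrite -(decr mu) -!e decr.
  have -> : s = 1%g by rewrite -[s]invgK s1 invg1.
  split => //; apply/eqP; apply: (bead_eq_inj smu sla) => i.
  by have := e i; rewrite s1 perm1 /staircase /bead; have := ltn_ord i; lia.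
under eq_bigr => s _ do rewrite sgn_coef term.
rewrite (bigD1 (1%g : 'S_N)) //= odd_perm1 eqxx mul1r big1 ?addr0 // => s /negbTE ->.
by rewrite mulr0.
Qed.

Section SchurBasis.
Variables (K : fieldType) (t : K).
Hypothesis t_tr : transcendental t.

Lemma transcendental_neq0 (p : {poly int}) : p != 0 -> (map_poly intr p).[t] != 0.
Proof. by apply: contraNneq => /t_tr ->. Qed.

Lemma transcendental_char0 n : n.+1%:R != 0 :> K.
Proof.
have : (n.+1%:Z)%:P != 0 by rewrite polyC_eq0.
by move/transcendental_neq0; rewrite map_polyC hornerC.
Qed.

Lemma transcendental_nonzero : t != 0.
Proof.
have : 'X != 0 :> {poly int} by rewrite polyX_eq0.
by move/transcendental_neq0; rewrite map_polyX hornerX.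
Qed.

Lemma transcendental_expr m n : t ^+ m = t ^+ n -> m = n.
Proof.
move=> e; have : (map_poly intr ('X^m - 'X^n : {poly int})).[t] = 0.
  by rewrite rmorphB /= !map_polyXn hornerD hornerN !hornerXn e subrr.
move/t_tr/eqP; rewrite subr_eq0 => /eqP /(congr1 (size : {poly int} -> nat)).
by rewrite !size_polyXn => -[].
Qed.

Lemma transcendental_qnum n : qnum t n.+1 != 0.
Proof.
have t0 := transcendental_nonzero.
rewrite qnumE // subr_eq0; apply/eqP => e.
have : t ^+ (12 * n.+1) = t ^+ 0.
  have R0 : (t ^+ 6) ^+ n.+1 != 0 by rewrite !expf_neq0.
  rewrite expr0 -(mulfV R0) -e -!exprM -exprD; congr (_ ^+ _); lia.
by move/transcendental_expr.
Qed.

Lemma map_alternant N M (mu : intpart) :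
  (map_poly intr (alternant (fun j : 'I_N => 'X^(M ^ j) : {poly int}) (staircase N mu))).[t]
  = alternant (fun j : 'I_N => t ^+ (M ^ j)) (staircase N mu).
Proof.
rewrite -horner_evalE /alternant -!det_map_mx; congr (\det _).
apply/matrixP => i j; rewrite !mxE rmorphXn /= map_polyXn.
by rewrite horner_evalE -exprM hornerXn exprM.
Qed.

(** Specialize at the point of [exists_bialternant] with x_j = t^(M^j) and M
    large.  A relation becomes an integral polynomial relation for t between
    alternants, hence an identity of polynomials, and [coef_alternant]
    extracts each coefficient. *)
Lemma schur_independent (c : intpart -> int) :
  finite_set [set mu | c mu != 0]%classic ->
  \sum_(mu \in [set: intpart]%classic) (c mu)%:~R *: schur K mu = 0 ->
  forall mu, c mu = 0.
Proof.
move=> fc sum0 mu0; apply/eqP/negPn/negP => c0.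
pose D := fset_set [set mu | c mu != 0]%classic.
have inD mu : (mu \in D) = (c mu != 0).
  by rewrite in_fset_set //; apply/idP/idP => [/set_mem|h] //; exact/mem_set.
pose N := \max_(mu <- D) size mu.
pose M := (\max_(mu <- D) head 0 mu + N).+1%N.
have sN mu : mu \in D -> (size mu <= N)%N.
  by move=> h; rewrite /N (big_fsetD1 mu) //= leq_maxl.
have hM mu : mu \in D -> (head 0 mu + N < M)%N.
  by move=> h; rewrite /M ltnS leq_add2r (big_fsetD1 mu) //= leq_maxl.
pose x (j : 'I_N) := t ^+ (M ^ j).
have x_inj : injective x.
  move=> i j /transcendental_expr e; apply: val_inj => /=.
  have M1 : (1 < M)%N.
    by have := hM mu0; rewrite inD => /(_ c0); have := ltn_ord i; lia.
  by apply/eqP; rewrite -(eqn_exp2l _ _ M1) e.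
have [h [C [h0 C0 hjt]]] := exists_bialternant x_inj.
have [phi newton] := exists_power_sums h0.
rewrite (fsbigTE D) in sum0; last first.
  by move=> mu; rewrite inD negbK => /eqP ->; rewrite scale0r.
have {sum0} : \sum_(mu <- D) (c mu)%:~R * alternant x (staircase N mu) = 0.
  apply: (mulIf C0); rewrite mul0r mulr_suml.
  transitivity (specialize phi (\sum_(mu <- D) (c mu)%:~R *: schur K mu)).
    rewrite specializeE rmorph_sum /= big_seq [RHS]big_seq; apply: eq_bigr => mu muD.
    rewrite -specializeE specializeZ -mulrA -hjt ?sN //.
    by rewrite /schur (specialize_skew transcendental_char0 h0 newton (N := N)) // sN.
  by rewrite sum0 specializeE rmorph0.
pose P : {poly int} := \sum_(mu <- D) c mu *:
  alternant (fun j : 'I_N => 'X^(M ^ j) : {poly int}) (staircase N mu).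
have -> : \sum_(mu <- D) (c mu)%:~R * alternant x (staircase N mu) = (map_poly intr P).[t].
  rewrite /P rmorph_sum /= horner_sum; apply: eq_bigr => mu _.
  by rewrite map_polyZ hornerZ map_alternant.
move/t_tr/(congr1 (fun p : {poly int} => p`_(\sum_(i < N) staircase N mu0 i * M ^ i))).
have mu0D : mu0 \in D by rewrite inD.
rewrite coef0 /P coef_sum (big_fsetD1 mu0) //= coefZ coef_alternant ?sN ?hM //.
rewrite eqxx mulr1 big_seq big1 ?addr0 => [e|mu]; first by rewrite e eqxx in c0.
rewrite in_fsetD1 => /andP[ne muD].
by rewrite coefZ coef_alternant ?sN ?hM // (negbTE ne) mulr0.
Qed.

Lemma schur_empty : schur K empty_part = 1.
Proof. by rewrite /schur /skew_schur /= det_mx00. Qed.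

Lemma lr_expansion_left_empty (la : intpart) :
  is_lr_expansion K empty_part la (fun mu => (mu == la)%:R).
Proof.
split.
  apply: (sub_finite_set _ (finite_set1 la)) => mu /=.
  by case: (mu =P la).
rewrite schur_empty mul1r (fsbigTE [fset la]%fset) ?big_seq_fset1 ?eqxx ?scale1r //.
by move=> mu; rewrite inE => /negbTE ->; rewrite scale0r.
Qed.

(** s_la is an expansion of s_0 s_la, and by linear independence the only one.
    *)
Lemma lr_coef_left_empty (mu la : intpart) : lr_coef K mu empty_part la = (mu == la)%:R.
Proof.
rewrite /lr_coef; case: xgetP => [c _ cP|/(_ (fun mu => (mu == la)%:R))]; last first.
  by case; exact: lr_expansion_left_empty.
have [fc ec] : is_lr_expansion K empty_part la c := cP.
have [fd ed] := lr_expansion_left_empty la.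
pose S := ([set mu | c mu != 0] `|` [set mu | (mu == la)%:R != 0 :> int])%classic.
have fu : finite_set S by rewrite finite_setU.
apply/eqP; rewrite -subr_eq0; apply/eqP.
apply: (schur_independent (c := fun mu => c mu - (mu == la)%:R)).
  apply: (sub_finite_set _ fu) => nu /=.
  case: (eqVneq (c nu) 0) => [->|]; last by left.
  by rewrite sub0r oppr_eq0; right.
pose D := fset_set S.
have out (f : intpart -> int) nu : (f nu != 0 -> S nu) -> nu \notin D ->
    (f nu)%:~R *: schur K nu = 0.
  move=> fS; rewrite in_fset_set // => /negP nD; case: (eqVneq (f nu) 0) => [->|/fS h].
    by rewrite scale0r.
  by case: nD; exact/mem_set.
have sumD (f : intpart -> int) : (forall nu, f nu != 0 -> S nu) ->
    \sum_(nu \in [set: intpart]%classic) (f nu)%:~R *: schur K nu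
    = \sum_(nu <- D) (f nu)%:~R *: schur K nu.
  by move=> fS; apply: fsbigTE => nu; apply: out; exact: fS.
rewrite (sumD c) in ec; last by move=> nu; left.
rewrite (sumD (fun nu => (nu == la)%:R)) in ed; last by move=> nu; right.
have e := etrans (esym ec) ed.
rewrite (sumD (fun nu => c nu - (nu == la)%:R)); last first.
  move=> nu; case: (eqVneq (c nu) 0) => [->|h _]; last by left.
  by rewrite sub0r oppr_eq0; right.
transitivity (\sum_(nu <- D) (c nu)%:~R *: schur K nu
  - \sum_(nu <- D) ((nu == la)%:R : int)%:~R *: schur K nu).
  by rewrite -sumrB; apply: eq_bigr => nu _; rewrite intrB scalerBl.
by apply/eqP; rewrite subr_eq0; apply/eqP; exact: e.
Qed.

(** Setting all power sums to zero kills everything in positive degree. *)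
Lemma specialize0_schur mu : specialize (fun=> 0) (schur K mu) = (mu == empty_part)%:R.
Proof.
pose h (n : nat) : K := (n == 0%N)%:R.
have newton n : n.+1%:R * h n.+1 = \sum_(k < n.+1) 0 * h (n - k)%N.
  by rewrite mulr0 big1 // => k _; rewrite mul0r.
rewrite /schur (specialize_skew transcendental_char0 (h := h) _ newton (leqnn _)) //.
have [->|ne] := eqVneq mu empty_part; first by rewrite /jt det_mx00.
have [N sN] : exists N, size mu = N.+1.
  exists (size mu).-1; rewrite prednK // lt0n size_eq0; apply: contra ne => /eqP e.
  by apply/eqP/val_inj.
rewrite /jt sN (expand_det_row _ ord0) big1 // => j _; rewrite mxE.
have : (0 < nth 0 mu 0)%N by rewrite nth_part_gt0 // sN.
rewrite /bead nth_nil /= => p0.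
have -> : (nth 0%N mu 0)%:Z - 1 - (0 - j.+1%:Z) = (nth 0%N mu 0 + j)%N by lia.
by rewrite /= /h addn_eq0 eqn0Ngt p0 mul0r.
Qed.

(** The constant term of s_eta s_tau is zero, while the expansion has constant
    term c empty_part. *)
Lemma lr_coef_empty (eta tau : intpart) : eta != empty_part ->
  lr_coef K empty_part eta tau = 0.
Proof.
move=> ne; rewrite /lr_coef; case: xgetP => [c _ cP|//].
have [fc ec] : is_lr_expansion K eta tau c := cP.
have := congr1 (specialize (fun=> 0)) ec.
rewrite {1}specializeE rmorphM /= -specializeE specialize0_schur (negbTE ne) mul0r.
rewrite (fsbigTE (fset_set [set mu | c mu != 0]%classic)); last first.
  move=> mu; rewrite in_fset_set // => /negP nD; case: (eqVneq (c mu) 0) => [->|h].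
    by rewrite scale0r.
  by case: nD; exact/mem_set.
rewrite specializeE rmorph_sum /=.
under eq_bigr => mu _ do rewrite -specializeE specializeZ specialize0_schur.
case: (eqVneq (c empty_part) 0) => // c0.
rewrite (big_fsetD1 empty_part) /=; last by rewrite in_fset_set //; exact/mem_set.
rewrite mulr1 big_seq big1 ?addr0; last first.
  by move=> mu; rewrite in_fsetD1 => /andP[/negbTE -> _]; rewrite mulr0.
move=> /esym/eqP e; have := @transcendental_neq0 (c empty_part)%:P.
by rewrite polyC_eq0 => /(_ c0); rewrite map_polyC hornerC /= e.
Qed.

End SchurBasis.

(** * The vertex with one empty leg *)

Section TwoPartitionVertex.
Variables (K : fieldType) (t : K).
Hypothesis t_tr : transcendental t.

Let t0 := transcendental_nonzero t_tr.
Let char0 := transcendental_char0 t_tr.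
Let qn0 := transcendental_qnum t_tr.
Let newton := complete_q_newton t0 qn0.

Lemma at_qmrho_skew N (mu nu : intpart) : (size mu <= N)%N -> (size nu <= N)%N ->
  at_qmrho t (skew_schur K mu nu) = jt (complete_q t) N mu nu.
Proof. exact: specialize_skew char0 (complete_q0 t) newton _ _ _. Qed.

Lemma size_part_gt0 (mu : intpart) : mu != empty_part -> (0 < size mu)%N.
Proof.
by rewrite lt0n size_eq0; apply: contra => /eqP e; apply/eqP/val_inj.
Qed.

Lemma conj_part_empty (mu : intpart) : conj_part mu = empty_part -> mu = empty_part.
Proof.
move=> e; apply: val_inj => /=; have : size (conj_part mu) = 0%N by rewrite e.
rewrite size_mkseq; case: (parts mu) (partsP mu) => //= x s.
by rewrite /is_part in_cons => /andP[_ /norP[]] + _ x0; rewrite x0 eqxx.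
Qed.

Lemma W2_empty_neq0 (nu : intpart) : W2 t nu empty_part != 0.
Proof.
rewrite /W2 (fsum_single (i0 := empty_part)); last first.
  move=> eta /size_part_gt0 s.
  by rewrite [X in _ * X](specialize_skew_long char0 (complete_q0 t) newton) ?mulr0.
rewrite !mulf_neq0 ?qpow12_neq0 ?expf_neq0 ?oppr_eq0 ?oner_eq0 //.
  by rewrite (at_qmrho_skew (N := size nu)) // jt_complete_q_neq0.
by rewrite (at_qmrho_skew (N := 0)) // /jt det_mx00 oner_eq0.
Qed.

(** With the third leg empty, eta and tau are empty and la = mu, and the two
    factors W_(nu, 0) cancel. *)
Lemma W3_empty (mu nu : intpart) :
  W3 t mu nu empty_part = qpow12 t (6%:Z * kappa nu) * W2 t (conj_part nu) mu.
Proof.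
have lr (la tau : intpart) : \sum_(eta \in [set: intpart]%classic)
     lr_coef K mu eta la * lr_coef K (conj_part empty_part) eta (conj_part tau)
   = ((mu == la) && (tau == empty_part))%:R.
  rewrite conj_empty_part (fsum_single (i0 := empty_part)); last first.
    by move=> eta ne; rewrite (lr_coef_empty t_tr) ?mulr0.
  rewrite !(lr_coef_left_empty t_tr) -mulnb natrM; congr (_ * _%:R).
  congr nat_of_bool; apply/eqP/eqP => [e|->]; last by rewrite conj_empty_part.
  exact/conj_part_empty/esym.
rewrite /W3 (fsum_single (i0 := mu)); last first.
  move=> la ne; apply: fsbig1 => tau _; rewrite lr eq_sym (negbTE ne) !mul0r //.
rewrite (fsum_single (i0 := empty_part)); last first.
  by move=> tau ne; rewrite lr (negbTE ne) andbF !mul0r.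
rewrite lr !eqxx mul1r conj_empty_part.
have -> : kappa empty_part = 0 by rewrite /kappa big_ord0.
by rewrite mulr0 addr0 mulfK ?W2_empty_neq0.
Qed.

Definition gram N (mu nu : intpart) : K :=
  \det (\matrix_(i < N, j < N) pairing N (complete_q t) (bead mu i) (bead nu j)).

Lemma sum_skew_gram N (mu nu : intpart) :
  (size mu <= N)%N -> (head 0 mu <= N)%N -> (size nu <= N)%N ->
  \sum_(eta \in [set: intpart]%classic)
    at_qmrho t (skew_schur K mu eta) * at_qmrho t (skew_schur K nu eta) = gram N mu nu.
Proof. exact: sum_skew char0 (complete_q0 t) newton. Qed.

Lemma gram_empty N : gram N empty_part empty_part = 1.
Proof.
rewrite -sum_skew_gram // (fsum_single (i0 := empty_part)); last first.
  by move=> eta /size_part_gt0 s;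
    rewrite [X in _ * X](specialize_skew_long char0 (complete_q0 t) newton) ?mulr0.
by rewrite (at_qmrho_skew (N := 0)) // /jt det_mx00 mulr1.
Qed.

Lemma framed_W3_gram N a1 a2 (mu nu : intpart) :
  (size mu <= N)%N -> (head 0 mu <= N)%N -> (size nu <= N)%N -> (head 0 nu <= N)%N ->
  framed_W3 t a1 a2 0 mu nu empty_part
  = (-1) ^+ (psize mu + psize nu)
    * qpow12 t (6%:Z * ((a1 + 1) * kappa mu + a2 * kappa nu))
    * gram N mu (conj_part nu).
Proof.
move=> smu hmu snu hnu; rewrite /framed_W3 W3_empty /W2.
under eq_fsbigr => eta _ do rewrite mulrC.
rewrite (sum_skew_gram (N := N)) ?size_mkseq // psize_conj kappa_conj addnC.
have -> : 6%:Z * ((a1 + 1) * kappa mu + a2 * kappa nu)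
  = 6%:Z * (a1 * kappa mu + a2 * kappa nu + 0 * kappa empty_part)
    + 6%:Z * kappa nu + 6%:Z * (- kappa nu + kappa mu) by lia.
by rewrite !qpow12D //; ring.
Qed.

Variables a1 a2 : int.

(** The framing is spread over the rows through kappa = sum k (k + 1) over
    beads minus vacuum.  In the first factor W itself contributes one more
    unit, whence a1 + 1; in the second this unit is cancelled by q^(kappa/2)
    in the vertex.  The factor t^(-2) = q^(-1/6) and the extra sign of the
    second factor cancel against those of the vacuum in total, and are needed
    to match A^{12} and A^{21}. *)
Definition mode_weight (i : bool) (k : int) : K :=
  if i then (-1) ^ (k + 1) * qpow12 t (6%:Z * a2 * (k * (k + 1)) - 2%:Z)
  else (-1) ^ k * qpow12 t (6%:Z * (a1 + 1) * (k * (k + 1))).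

Arguments mode_weight : simpl never.

Lemma prod_exprz (I : Type) (s : seq I) (x : K) (g : I -> int) : x != 0 ->
  \prod_(i <- s) x ^ g i = x ^ (\sum_(i <- s) g i).
Proof.
move=> x0; elim: s => [|i s IH]; first by rewrite !big_nil expr0z.
by rewrite !big_cons IH expfzDr.
Qed.

Lemma sum_beads_const N (mu nu : intpart) (c : int) :
  \sum_(k <- beads N mu) c = \sum_(k <- beads N nu) c.
Proof. by rewrite !(sum_beads N _ (fun=> c)). Qed.

Lemma prod_mode_weight_false N (mu : intpart) : (size mu <= N)%N ->
  \prod_(k <- beads N mu) mode_weight false k
  = (-1) ^+ psize mu * qpow12 t (6%:Z * (a1 + 1) * kappa mu)
    * \prod_(k <- beads N empty_part) mode_weight false k.
Proof.
move=> smu; have n1 : (-1 : K) != 0 by rewrite oppr_eq0 oner_eq0.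
rewrite /mode_weight !big_split /= /qpow12 !prod_exprz // -!mulr_sumr.
rewrite exprnP (psize_beads smu) (kappa_beads smu).
rewrite mulrACA -!expfzDr //; congr (_ ^ _ * _ ^ _).
  by rewrite addrNK.
by rewrite mulrBr subrK.
Qed.

Lemma prod_mode_weight_true N (nu : intpart) : (size nu <= N)%N ->
  \prod_(k <- beads N nu) mode_weight true k
  = (-1) ^+ psize nu * qpow12 t (6%:Z * a2 * kappa nu)
    * \prod_(k <- beads N empty_part) mode_weight true k.
Proof.
move=> snu; have n1 : (-1 : K) != 0 by rewrite oppr_eq0 oner_eq0.
rewrite /mode_weight !big_split /= /qpow12 !prod_exprz // !big_split /= -!mulr_sumr.
rewrite exprnP (psize_beads snu) (kappa_beads snu).
rewrite mulrACA -!expfzDr //; congr (_ ^ _ * _ ^ _).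
  by rewrite (sum_beads_const N nu empty_part) addrA addrNK.
by rewrite (sum_beads_const N nu empty_part) mulrBr addrA subrK.
Qed.

Lemma mode_weight_neq0 i k : mode_weight i k != 0.
Proof.
have n1 : (-1 : K) != 0 by rewrite oppr_eq0 oner_eq0.
by rewrite /mode_weight; case: i; rewrite mulf_neq0 ?qpow12_neq0 ?expfz_neq0.
Qed.

Lemma exprN1_Negz n : (-1 : K) ^ Negz n = (-1) ^+ n.+1.
Proof. by rewrite NegzE -exprz_inv invrN1. Qed.

Local Notation h := (complete_q t).
Local Notation e := (elementary_q t).

Lemma sign_square n : (-1) ^+ n * (-1) ^+ n = 1 :> K.
Proof. by rewrite -expr2 sqrr_sign. Qed.

Lemma mode_weight_false k : mode_weight false k
  = (-1) ^ k * qpow12 t (6%:Z * (a1 + 1) * (k * (k + 1))).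
Proof. by []. Qed.

Lemma mode_weight_true k : mode_weight true k * (-1) ^ (k + 1)
  = qpow12 t (6%:Z * a2 * (k * (k + 1)) - 2%:Z).
Proof.
by rewrite /mode_weight mulrAC -expfzMl mulrNN mulr1 exp1rz mul1r.
Qed.

Lemma A_diag1_hook m n : A_diag t a1 m n * mode_weight false (Negz n)
  = mode_weight false (Posz m) * hook e h m n.
Proof.
rewrite /A_diag !mode_weight_false hook_q // exprN1_Negz -exprnP.
have : qpow12 t (3%:Z * (2%:Z * a1 + 1) * ((m * m.+1)%:Z - (n * n.+1)%:Z))
    * qpow12 t (6%:Z * (a1 + 1) * (Negz n * (Negz n + 1)))
  = qpow12 t (6%:Z * (a1 + 1) * (m%:Z * (m%:Z + 1)))
    * qpow12 t (3%:Z * ((n * n.+1)%:Z - (m * m.+1)%:Z)).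
  by rewrite -!qpow12D //; congr qpow12; rewrite NegzE; nia.
move: (qpow12 t _) (qpow12 t _) (qpow12 t _) (qpow12 t _) (_^-1) => D C B A den E.
transitivity ((-1) ^+ n * (-1) ^+ n * - (A * B * den)); first by rewrite exprS; ring.
transitivity ((-1) ^+ m * (-1) ^+ m * - (C * D * den)); last by rewrite exprS; ring.
by rewrite !sign_square E.
Qed.

Lemma A_diag2_hook m n :
  A_diag t a2 m n * (mode_weight true (Negz n) * (-1) ^ (Negz n + 1))
  = - (mode_weight true (Posz m) * (-1) ^ (Posz m + 1)) * hook e h n m.
Proof.
rewrite /A_diag !mode_weight_true hook_q // [(n + m)%N]addnC.
rewrite [qnum t _ * qfact t n * _]mulrAC.
have : qpow12 t (3%:Z * (2%:Z * a2 + 1) * ((m * m.+1)%:Z - (n * n.+1)%:Z))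
    * qpow12 t (6%:Z * a2 * (Negz n * (Negz n + 1)) - 2%:Z)
  = qpow12 t (6%:Z * a2 * (m%:Z * (m%:Z + 1)) - 2%:Z)
    * qpow12 t (3%:Z * ((m * m.+1)%:Z - (n * n.+1)%:Z)).
  by rewrite -!qpow12D //; congr qpow12; rewrite NegzE; nia.
move: (qpow12 t _) (qpow12 t _) (qpow12 t _) (qpow12 t _) (_^-1) => D C B A den E.
transitivity ((-1) ^+ n * (A * B * den)); first by ring.
by rewrite E exprS; ring.
Qed.

Lemma A_12_overlap m n :
  A_12 t a1 a2 m n * (mode_weight true (Negz n) * (-1) ^ (Negz n + 1))
  = mode_weight false (Posz m) * overlap h m n.
Proof.
rewrite /A_12 mode_weight_true mode_weight_false overlap_complete_q // -exprnP.
have : qpow12 t (3%:Z * ((2%:Z * a1 + 1) * (m * m.+1)%:Z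
                  - (2%:Z * a2 + 1) * (n * n.+1)%:Z) + 2%:Z)
    * qpow12 t (6%:Z * a2 * (Negz n * (Negz n + 1)) - 2%:Z)
  = qpow12 t (6%:Z * (a1 + 1) * (m%:Z * (m%:Z + 1)))
    * qpow12 t (- (3%:Z * ((m * m.+1)%:Z + (n * n.+1)%:Z))).
  by rewrite -!qpow12D //; congr qpow12; rewrite NegzE; nia.
move: (\sum_(s < _) _) => S.
move: (qpow12 t _) (qpow12 t _) (qpow12 t _) (qpow12 t _) => D C B A E.
transitivity ((-1) ^+ n * (A * B * S)); first by ring.
transitivity ((-1) ^+ m * (-1) ^+ m * ((-1) ^+ n * (C * D * S))).
  by rewrite sign_square E mul1r.
by rewrite exprD; ring.
Qed.

Lemma A_21_overlap m n :
  A_21 t a1 a2 m n * mode_weight false (Negz n)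
  = mode_weight true (Posz m) * (-1) ^ (Posz m + 1) * overlap e m n.
Proof.
rewrite /A_21 mode_weight_true mode_weight_false overlap_elementary_q // exprN1_Negz.
have : qpow12 t (3%:Z * ((2%:Z * a2 + 1) * (m * m.+1)%:Z
                  - (2%:Z * a1 + 1) * (n * n.+1)%:Z) - 2%:Z)
    * qpow12 t (6%:Z * (a1 + 1) * (Negz n * (Negz n + 1)))
  = qpow12 t (6%:Z * a2 * (m%:Z * (m%:Z + 1)) - 2%:Z)
    * qpow12 t (3%:Z * ((m * m.+1)%:Z + (n * n.+1)%:Z)).
  by rewrite -!qpow12D //; congr qpow12; rewrite NegzE; nia.
move: (\sum_(s < _) _) => S.
move: (qpow12 t _) (qpow12 t _) (qpow12 t _) (qpow12 t _) => D C B A E.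
transitivity ((-1) ^+ n * (-1) ^+ n * (A * B * S)); first by rewrite exprS; ring.
by rewrite E sign_square; ring.
Qed.

(** The identities between the coefficients A^{ij}_{mn} and the hooks and
    overlaps turn the two relations of the pairing into the hypothesis of
    [fexp_bilinear]. *)
Lemma particle_row_relation N i (m : nat) : (m < N)%N ->
  state_row N (pairing N h) mode_weight (i, Posz m)
  = \sum_(j : bool) \sum_(n < N) A_coef t a1 a2 i j m n
      *: state_row N (pairing N h) mode_weight (j, Negz n).
Proof.
move=> mN; apply/rowP => c; rewrite big_bool mxE mxE !summxE.
have : nth 0 (window N) c \in window N by rewrite mem_nth // size_window.
rewrite mem_window => /andP[z1 z2].
set z := nth 0 (window N) c in z1 z2 *.
have eh := convolution_q t0 qn0.
have flipN n : flip (Negz n) = n by rewrite /flip; lia.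
transitivity (\sum_(n < N) A_coef t a1 a2 i true m n
      * (mode_weight true (Negz n) * (-1) ^ (Negz n + 1)) * (z == Posz n)%:R
  + \sum_(n < N) A_coef t a1 a2 i false m n * mode_weight false (Negz n)
      * pairing N h (Negz n) z); last first.
  congr (_ + _); apply: eq_bigr => n _; rewrite !mxE -/z /state_entry /=.
    by rewrite flipN !mulrA.
  by rewrite mulrA.
case: i; rewrite /state_entry /A_coef [LHS]/=.
  have -> : flip m = Negz m by rewrite /flip; lia.
  under eq_bigr => n _ do rewrite A_diag2_hook mulNr mulNr -mulrA.
  under [X in _ = _ + X]eq_bigr => n _ do rewrite A_21_overlap -mulrA.
  rewrite sumrN -!mulr_sumr pairing_hole_inverse //.
  by rewrite mulrDr addrCA addNr addr0 mulrA.
under eq_bigr => n _ do rewrite A_12_overlap -mulrA.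
under [X in _ = _ + X]eq_bigr => n _ do rewrite A_diag1_hook -mulrA.
by rewrite -!mulr_sumr -mulrDr addrC -pairing_particle.
Qed.

(** Stated over any field with a transcendental element, which is all that the
    argument uses of the scalars. *)
Theorem framed_W3_fock (mu nu : intpart) :
  framed_W3 t a1 a2 0 mu nu empty_part
  = bra2 mu nu (T_op t a1 a2 (ket2 K empty_part empty_part)).
Proof.
(* N is even for the sake of the Koszul signs. *)
pose N := (maxn (maxn (size mu) (head 0 mu)) (maxn (size nu) (head 0 nu))).*2.
have [smu hmu snu hnu] : [/\ (size mu <= N)%N, (head 0 mu <= N)%N,
    (size nu <= N)%N & (head 0 nu <= N)%N] by split; rewrite /N -addnn;
    apply: leq_trans (leq_addr _ _); rewrite !leq_max leqnn ?orbT.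
have N_even : ~~ odd N by rewrite odd_double.
pose Y := state_row N (pairing N h) mode_weight.
pose w : K := (\prod_(k <- beads N empty_part) mode_weight false k)
  * (\prod_(k <- beads N empty_part) mode_weight true k).
have DE (al be : intpart) : (size al <= N)%N -> (size be <= N)%N -> (head 0 be <= N)%N ->
    rdet (false, 0) Y (state_seq (beads N al) (beads N be))
    = (-1) ^+ (psize al + psize be)
      * qpow12 t (6%:Z * ((a1 + 1) * kappa al + a2 * kappa be))
      * gram N al (conj_part be)
      * w.
  move=> sal sbe hbe; rewrite rdet_state // -/(gram N al _).
  rewrite prod_mode_weight_false // prod_mode_weight_true //.
  have -> : 6%:Z * ((a1 + 1) * kappa al + a2 * kappa be)
    = 6%:Z * (a1 + 1) * kappa al + 6%:Z * a2 * kappa be by lia.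
  by rewrite qpow12D // exprD /w; ring.
have w0 : w != 0.
  by rewrite /w mulf_neq0 // prodf_seq_neq0; apply/allP => k _; exact: mode_weight_neq0.
have D_vac : rdet (false, 0) Y (occ_seq N (maya empty_part, maya empty_part)) = w.
  rewrite occ_seq_maya // DE // conj_empty_part gram_empty.
  have -> : kappa empty_part = 0 by rewrite /kappa big_ord0.
  by rewrite !(mulr0, addr0) /= /qpow12 !mul1r.
rewrite /bra2.
have -> : T_op t a1 a2 = fexp (bilinear (A_coef t a1 a2)) by [].
rewrite (fexp_bilinear N_even (Y := Y)) ?D_vac //.
- by rewrite occ_seq_maya // DE // mulfK // (framed_W3_gram (N := N)).
- by move=> i m; exact: particle_row_relation.
- exact: confined_maya.
- by rewrite occ_seq_maya // size_cat !size_map !size_iota.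
Qed.

End TwoPartitionVertex.

Lemma q12_transcendental (R : realType) : transcendental (q12 R).
Proof.
move=> p.
have <- : tofrac (map_poly intr p : {poly R[i]}) = (map_poly intr p).[q12 R].
  elim/poly_ind: p => [|p c IH]; first by rewrite !rmorph0 horner0.
  rewrite !rmorphD !rmorphM /= !map_polyX !map_polyC hornerD hornerMX hornerC -IH /=.
  by congr (_ + _); rewrite !rmorph_int.
move/eqP; rewrite tofrac_eq0 => /eqP p0; apply/polyP => i; apply/eqP.
have := congr1 (fun q : {poly R[i]} => q`_i) p0.
rewrite /= coef_map !coef0 /= => e.
by rewrite -(intr_eq0 R[i]) e.
Qed.

Theorem theorem5p1 (R : realType) (a1 a2 : int) (mu nu : intpart) :
  framed_W3 (q12 R) a1 a2 0 mu nu empty_part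
  = bra2 mu nu (T_op (q12 R) a1 a2 (ket2 (scalars R) empty_part empty_part)).
Proof. exact: framed_W3_fock (@q12_transcendental R) _ _ _ _. Qed.
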